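(* Let $K$ be a field, let $X = (x_{ij})_{1\le i\le m,\ 1\le j\le n}$ be an $m\times n$ matrix of indeterminates, and let $A = K[x_{ij} : 1\le i\le m,\ 1\le j\le n]$. Let $\mathcal{M}$ be a set of adjacent $2$-minors of $X$, and let $I_{\mathcal{M}}$ be the ideal of $A$ generated by all $2$-minors belonging to $\mathcal{M}$. Then there exists a finite simple graph $G$ such that $I_{\mathcal{M}} = I_G$ (where $I_G$ is the toric ideal of $G$, and the equality is understood after identifying the variables $x_{ij}$ of $A$ with the edge variables of $G$ by some bijection) if and only if all of the following hold: $\mathcal{M}$ is of chessboard type; the graph $\Gamma_{\mathcal{M}}$ possesses no cycle of length $4$; and each connected component of $\Gamma_{\mathcal{M}}$ possesses at most one cycle.
   Context: **Adjacent $2$-minors.** For $1\le a_1<a_2\le m$ and $1\le b_1<b_2\le n$, the symbol $[a_1,a_2|b_1,b_2]$ denotes the $2$-minor $x_{a_1b_1}x_{a_2b_2}-x_{a_1b_2}x_{a_2b_1}$ of $X$. It is called adjacent if $a_2=a_1+1$ and $b_2=b_1+1$. **Chessboard type.** A set $\mathcal{M}$ of adjacent $2$-minors of $X$ is of chessboard type if the following two conditions hold: (1) if $[a,a+1|b,b+1]$ and $[a,a+1|b',b'+1]$ with $b<b'$ belong to $\mathcal{M}$, then $b+1<b'$; (2) if $[a,a+1|b,b+1]$ and $[a',a'+1|b,b+1]$ with $a<a'$ belong to $\mathcal{M}$, then $a+1<a'$. **The graph $\Gamma_{\mathcal{M}}$.** For a set $\mathcal{M}$ of adjacent $2$-minors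 of chessboard type, $\Gamma_{\mathcal{M}}$ is the finite graph with vertex set $\mathcal{M}$ whose edges are the pairs $\{[a,a+1|b,b+1],\,[a',a'+1|b',b'+1]\}$ such that $[a,a+1|b,b+1]\neq[a',a'+1|b',b'+1]$, $\{a,a+1\}\cap\{a',a'+1\}\neq\emptyset$ and $\{b,b+1\}\cap\{b',b'+1\}\neq\emptyset$. **Toric ideal of a graph.** A finite graph is simple if it has no loops and no multiple edges. Let $G$ be a finite simple graph on the vertex set $\{1,\dots,d\}$ with edge set $E(G)=\{e_1,\dots,e_N\}$. Let $K[t_1,\dots,t_d]$ be the polynomial ring in $d$ variables over $K$, and for $e=\{i,j\}\in E(G)$ put $\mathbf{t}^e=t_it_j$. The edge ring $K[G]$ is the $K$-subalgebra of $K[t_1,\dots,t_d]$ generated by the monomials $\mathbf{t}^e$ with $e\in E(G)$. Let $K[y_1,\dots,y_N]$ be the polynomial ring in $N$ variables over $K$. The toric ideal $I_G$ of $G$ is the kernel of the surjective $K$-algebra homomorphism $\pi:K[y_1,\dots,y_N]\to K[G]$ defined by $\pi(y_k)=\mathbf{t}^{e_k}$ for $k=1,\dots,N$. **Meaning of $I_{\mathcal{M}}=I_G$.** There is a bijection between the variables $x_{ij}$ of $A$ and the variables $y_1,\dots,y_N$ (equivalently, the edges of $G$) such that the induced $K$-algebra isomorphism $A\cong K[y_1,\dots,y_N]$ maps $I_{\mathcal{M}}$ onto $I_G$. *)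

(* Defs.v *)
From mathcomp Require Import all_boot all_order all_algebra.
From mathcomp Require Import mpoly.

Set Implicit Arguments.
Unset Strict Implicit.
Unset Printing Implicit Defensive.

Import GRing.Theory.
Local Open Scope ring_scope.

(* K[x_ij : i < m, j < n] is {mpoly K[m * n]}; the indices of rows and columns
   start at 0. *)
Definition generic_mx (K : fieldType) (m n : nat) :
    'M[{mpoly K[m * n]}]_(m, n) :=
  \matrix_(i, j) 'X_(mxvec_index i j).

(* ((a1, a2), (b1, b2)) stands for the symbol [a1,a2|b1,b2]. *)
Notation minor_index m n := (('I_m * 'I_m) * ('I_n * 'I_n))%type.

Section Minors.
Variables (K : fieldType) (m n : nat).
Implicit Types (p q : minor_index m n) (M : {set minor_index m n}).

Definition minor2 q : {mpoly K[m * n]} :=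
  let: ((a1, a2), (b1, b2)) := q in
  let X := generic_mx K m n in
  X a1 b1 * X a2 b2 - X a1 b2 * X a2 b1.

Definition adjacent q : bool :=
  let: ((a1, a2), (b1, b2)) := q in
  (a2 == a1.+1 :> nat) && (b2 == b1.+1 :> nat).

(* To be used for sets M of adjacent minors: there q.1.2 = q.1.1 + 1 and
   q.2.2 = q.2.1 + 1. *)
Definition chessboard M : Prop :=
  (forall p q, p \in M -> q \in M -> p.1 = q.1 ->
     (p.2.1 < q.2.1)%N -> (p.2.2 < q.2.1)%N) /\
  (forall p q, p \in M -> q \in M -> p.2 = q.2 ->
     (p.1.1 < q.1.1)%N -> (p.1.2 < q.1.1)%N).

Definition minor_rows q : {set 'I_m} := [set q.1.1; q.1.2].
Definition minor_cols q : {set 'I_n} := [set q.2.1; q.2.2].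

(* Edges of Gamma_M; its vertex set is M. *)
Definition Gamma M : rel (minor_index m n) := fun p q =>
  [&& p \in M, q \in M, p != q,
      minor_rows p :&: minor_rows q != set0 &
      minor_cols p :&: minor_cols q != set0].

End Minors.

Definition in_generated_ideal (R : comNzRingType) (I : finType) (S : {set I})
    (g : I -> R) (f : R) : Prop :=
  exists c : I -> R, f = \sum_(i in S) c i * g i.

Definition in_minor_ideal (K : fieldType) (m n : nat)
    (M : {set minor_index m n}) (f : {mpoly K[m * n]}) : Prop :=
  in_generated_ideal M (@minor2 K m n) f.

Section Cycles.
Variables (T : finType) (e : rel T).

Definition graph_cycle (s : seq T) : bool := (2 < size s)%N && ucycleb e s.

(* The same cycle of a graph is traversed by several sequences (choice of the
   starting vertex and of the direction); it is determined by its edge set. *)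
Definition cycle_edges (s : seq T) : {set {set T}} :=
  [set [set x; next s x] | x in s].

Definition no_cycle_of_length (l : nat) : Prop :=
  forall s, graph_cycle s -> size s <> l.

(* The graph is (V, e), and connect e x is the component of x \in V. *)
Definition components_at_most_one_cycle (V : {set T}) : Prop :=
  forall x, x \in V -> forall s1 s2,
    graph_cycle s1 -> {subset s1 <= connect e x} ->
    graph_cycle s2 -> {subset s2 <= connect e x} ->
    cycle_edges s1 = cycle_edges s2.

End Cycles.

(* Finite simple graphs with vertex set 'I_d, given by their edge sets. *)
Record sgraph (d : nat) := SGraph {
  edges : {set {set 'I_d}};
  edgesP : forall e, e \in edges -> #|e| = 2 }.

Section ToricIdeal.
Variables (K : fieldType) (d : nat) (G : sgraph d).

Definition edge_monomial (e : {set 'I_d}) : {mpoly K[d]} := \prod_(i in e) 'X_i.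

(* pi, followed by the inclusion of the edge ring K[G] into K[t_1, ..., t_d];
   y_k corresponds to the k-th edge enum_val k. *)
Definition toric_map (f : {mpoly K[#|edges G|]}) : {mpoly K[d]} :=
  comp_mpoly [tuple edge_monomial (enum_val k) | k < #|edges G|] f.

Definition in_toric_ideal (f : {mpoly K[#|edges G|]}) : Prop :=
  toric_map f = 0.

End ToricIdeal.

Definition rename_vars (K : fieldType) (k l : nat) (s : 'I_k -> 'I_l)
    (f : {mpoly K[k]}) : {mpoly K[l]} :=
  comp_mpoly [tuple 'X_(s i) | i < k] f.

Definition equal_up_to_renaming (K : fieldType) (k l : nat)
    (I : {mpoly K[k]} -> Prop) (J : {mpoly K[l]} -> Prop) : Prop :=
  exists2 s : 'I_k -> 'I_l, bijective s &
    forall g, J g <-> exists2 f, I f & rename_vars s f = g.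

(* Main.v *)
Require Import Defs.
From mathcomp Require Import all_boot all_order all_algebra.
From mathcomp Require Import mpoly zify ring lra.
From Stdlib Require Import Classical.

Set Implicit Arguments.
Unset Strict Implicit.
Unset Printing Implicit Defensive.

Import Order.TTheory GRing.Theory Num.Theory.
Local Open Scope ring_scope.

(** The variables of A are the cells of the matrix. A graph whose edges are the
    cells presents the ideal I_M iff I_M is the kernel of the substitution that
    sends a cell to the product of its two vertices ([toric_presentation]).

    Necessity.  If I_M is such a kernel, then every minor of M is a 4-cycle of G
    whose opposite edges are the terms of the minor ([block_shape]).  If M is not
    of chessboard type, or if Gamma has a 4-cycle, then cancelling common cells in
    the relations leaves a binomial in the kernel that does not vanish at some
    common zero of M.  Suppose that a component of Gamma has two cycles.  Let a
    weight on the cells be balanced if the minors of M are homogeneous for it. As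
    the kernel is homogeneous too, every balanced weight is a sum over the
    endpoints of a function on the vertices of G ([balanced_vertex_potential]).
    On the other hand, the minors that contain a given vertex of G form walks in
    Gamma that turn at every step; as Gamma has no 4-cycle, these are staircases
    and do not close up ([no_endless_staircase], [Gamma_at_acyclic]).  So there
    is freedom to build a balanced weight from functions on the vertices of the
    single 4-cycles that agree except across one given edge of Gamma, where they
    jump by 1 ([local_potential]).  The difference of these local functions and
    the global one changes sign along every edge of every 4-cycle; if the edge
    of Gamma is on a cycle, then this difference is 1/2 on one side of it and
    -1/2 on the other ([edge_defect_cycle]).  For two edges, one on the second
    cycle and one on the first cycle only, the product of the two differences is
    constant along the second cycle except for a change of sign across one edge,
    which is absurd ([toric_at_most_one_cycle]).

    Sufficiency.  The graph is obtained by gluing one 4-cycle for each minor along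
    the shared cells, so that rows and columns are kept apart, but with rows and
    columns exchanged at one cell of every cycle of Gamma ([ends]).  Every
    balanced weight comes from the vertices of this graph: the splittings of the
    weight into a row part and a column part on the single blocks can be adjusted
    to each other along the forest that remains of Gamma, and at an exchange there
    is one equation for the one free constant of the component
    ([adjusting_constants], [ends_vertex_potential]).  Dually, two monomials with
    the same image differ by a rational combination of the relations in M.  Call
    the diagonal of a minor leading if its upper row is even, and the antidiagonal
    if it is odd.  Then no cell is leading in two minors, and every monomial can be
    reduced modulo I_M to a normal one, not divisible by any leading term.  If two
    normal monomials had the same image, the minors with the largest coefficient
    in their difference would contain an endless staircase ([normal_inj]).  So
    I_M is the whole kernel ([minor_idealE]). *)

(** * Cycles and potentials in finite graphs *)

Section GraphLemmas.
Variable T : finType.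
Implicit Types (r : rel T) (s : seq T).

Definition remove_edge r (E : {set T}) : rel T :=
  fun a b => r a b && ([set a; b] != E).

Lemma remove_edge_sym r E : ssrbool.symmetric r -> ssrbool.symmetric (remove_edge r E).
Proof. by move=> rC a b; rewrite /remove_edge rC setUC. Qed.

Lemma eq_set2 (a b x y : T) :
  [set a; b] = [set x; y] -> (a = x /\ b = y) \/ (a = y /\ b = x).
Proof.
move=> E.
have: a \in [set x; y] by rewrite -E set21.
have: b \in [set x; y] by rewrite -E set22.
have: x \in [set a; b] by rewrite E set21.
have: y \in [set a; b] by rewrite E set22.
rewrite !inE.
do 4![case/orP => /eqP ?]; subst; by [left | right].
Qed.

Lemma graph_cycle_arc r s x : graph_cycle r s -> x \in s ->
  exists p, [/\ path r (next s x) (rcons p x), uniq (x :: next s x :: p),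
                p != [::] & x :: next s x :: p =i s].
Proof.
case/andP=> sz3 /andP[cyc us] xs.
case: (rot_to xs) => i t def_t.
have ut : uniq (x :: t) by rewrite -def_t rot_uniq.
have cyct : cycle r (x :: t) by rewrite -def_t rot_cycle.
have szt : (2 < size (x :: t))%N by rewrite -def_t size_rot.
have memt : x :: t =i s by move=> z; rewrite -def_t mem_rot.
have nx : next s x = next (x :: t) x by rewrite -def_t next_rot.
case: t => [|y p] // in def_t ut cyct szt memt nx *.
have {}nx : next s x = y by rewrite nx /= eqxx.
exists p; rewrite nx; split=> //; last by case: (p) szt.
by move: cyct => /= /andP[].
Qed.

(** Going around a cycle the other way avoids any one of its edges. *)
Lemma graph_cycle_connect r s x : ssrbool.symmetric r -> graph_cycle r s -> x \in s ->
  {in s &, forall a b, connect (remove_edge r [set x; next s x]) a b}.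
Proof.
move=> rC cyc xs; have [p [pp up pn0 mem]] := graph_cycle_arc cyc xs.
set y := next s x in pp up mem *; set r' := remove_edge _ _.
have {}pp : path r' y (rcons p x).
  move: up; rewrite !cons_uniq inE negb_or => /andP[/andP[xy xp] /andP[yp up]].
  move: pp; rewrite !rcons_path => /andP[pp lx]; apply/andP; split.
    apply: (sub_in_path (P := predC1 x)) pp => /=.
      move=> a b ax bx rab; rewrite /r' /remove_edge rab /=.
      by apply/eqP=> /eq_set2[[/eqP]|[_ /eqP]]; rewrite ?(negPf ax) ?(negPf bx).
    apply/andP; split; first by rewrite eq_sym.
    by apply/allP=> z zp /=; apply: contraNneq xp => <-.
  rewrite /r' /remove_edge lx /=.
  have lp : last y p \in p by case: (p) pn0 => //= a l _; rewrite mem_last.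
  apply/eqP=> /eq_set2[[lE _]|[lE _]]; first by rewrite lE (negPf xp) in lp.
  by rewrite lE (negPf yp) in lp.
have con b : b \in s -> connect r' y b.
  rewrite -mem inE => /orP[/eqP->|].
    by apply/connectP; exists (rcons p x) => //; rewrite last_rcons.
  move=> bp; move: (path_connect pp) => /(_ b); apply.
  by move: bp; rewrite !inE mem_rcons inE => /orP[->|->]; rewrite ?orbT.
have r'C := remove_edge_sym [set x; y] rC.
move=> a b /con ya /con yb; apply: connect_trans yb.
by rewrite sym_connect_sym.
Qed.

Lemma graph_cycle_next r s x : graph_cycle r s -> x \in s ->
  [/\ next s x \in s, r x (next s x) & x != next s (next s x)].
Proof.
move=> cyc xs; have [sz /andP[cs us]] := andP cyc.
split; [by rewrite mem_next | exact: next_cycle |].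
case/rot_to: xs => i t E; have ut : uniq (rot i s) by rewrite rot_uniq.
rewrite -!(next_rot i us) E; move: sz ut; rewrite -(size_rot i) E.
case: t {E} => [|y [|z t]] //= _ /and3P[+ + _].
rewrite !inE !negb_or => /and3P[xy xz _] _.
by rewrite eqxx [y == x]eq_sym (negPf xy) eqxx.
Qed.

Lemma cycle_edgeP s (E : {set T}) :
  reflect (exists2 x, x \in s & E = [set x; next s x]) (E \in cycle_edges s).
Proof. exact: imsetP. Qed.

Lemma graph_cycle_remove r s E :
  graph_cycle r s -> E \notin cycle_edges s -> graph_cycle (remove_edge r E) s.
Proof.
move=> cyc nE; have [sz /andP[cs us]] := andP cyc.
rewrite /graph_cycle sz /ucycleb us andbT /=.
apply/cycle_from_next => // x xs; have [_ rx _] := graph_cycle_next cyc xs.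
rewrite /remove_edge rx; apply: contraNneq nE => <-.
by apply/cycle_edgeP; exists x.
Qed.

Lemma sub_graph_cycle r r' s : subrel r r' -> graph_cycle r s -> graph_cycle r' s.
Proof. by move=> rr' /and3P[sz cs us]; apply/and3P; split=> //; apply: sub_cycle cs. Qed.

(** A forest has no cohomology: every antisymmetric function on its edges is a
    difference of vertex values.  Removing an edge separates its endpoints, so
    the values on one side can be shifted to satisfy the removed edge too. *)
Lemma acyclic_potential (V : zmodType) r (chi : T -> T -> V) :
  ssrbool.symmetric r -> irreflexive r -> (forall s, ~~ graph_cycle r s) ->
  (forall x y, chi y x = - chi x y) ->
  exists N : T -> V, forall x y, r x y -> N y = N x + chi x y.
Proof.
have [k] := ubnP #|[set E | [exists x, [exists y, r x y && (E == [set x; y])]]]|.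
elim: k r => // k IHk r leE rC rI acyc chiN.
case: (pickP (fun p : T * T => r p.1 p.2)) => [[x y] /= rxy | none]; last first.
  by exists (fun=> 0) => x y; have := none (x, y) => /= ->.
pose r' := remove_edge r [set x; y].
have r'C : ssrbool.symmetric r' := remove_edge_sym _ rC.
have rr' : subrel r' r by move=> a b /andP[].
have [||||N NP] := IHk r' _ r'C.
- move: leE; rewrite ltnS; apply: leq_trans; apply: proper_card; apply/properP; split.
    apply/subsetP=> E; rewrite !inE => /existsP[a /existsP[b /andP[/rr' rab Eab]]].
    by apply/existsP; exists a; apply/existsP; exists b; rewrite rab.
  exists [set x; y]; rewrite !inE.
    by apply/existsP; exists x; apply/existsP; exists y; rewrite rxy eqxx.
  apply/existsP=> -[a /existsP[b /andP[/andP[_ /eqP nE] /eqP E]]].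
  by case: nE.
- by move=> a; apply/negbTE/negP=> /rr'; rewrite rI.
- by move=> s; apply: contra (acyc s); apply: sub_graph_cycle.
- exact: chiN.
have ncon : ~~ connect r' y x.
  apply/negP=> /connectP[p pp xE].
  case/shortenP: pp xE => {}p pp up _ xE.
  have : graph_cycle r (y :: p).
    apply/and3P; split=> //; last first.
      rewrite /= rcons_path (sub_path rr' pp) /=.
      by rewrite -xE.
    case: p xE pp up => [|a [|b p]] //=.
      by move=> E; rewrite E rI in rxy.
    by move=> <-; rewrite /r' /remove_edge setUC eqxx andbF.
  by rewrite (negPf (acyc _)).
have r'C2 : connect_sym r' by apply: sym_connect_sym.
exists (fun z => N z + (if connect r' y z then N x + chi x y - N y else 0)).
move=> a b rab.
have [E|nE] := eqVneq [set a; b] [set x; y].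
  case/eq_set2: E => -[-> ->].
    by rewrite connect0 (negPf ncon) addr0 addrC subrK.
  by rewrite connect0 (negPf ncon) addr0 [chi y x]chiN addrCA subrr addr0 addrK.
have r'ab : r' a b by rewrite /r' /remove_edge rab.
by rewrite (NP _ _ r'ab) (same_connect_r r'C2 (connect1 r'ab)) addrAC.
Qed.
End GraphLemmas.

(** * Linear algebra and ideals *)

Section Duality.

(** Double orthogonality for the row space of a matrix. *)
Lemma orthogonal_span (F : fieldType) (I : finType) (N : nat)
    (w : I -> 'I_N -> F) (z : 'I_N -> F) :
  (forall y : 'I_N -> F, (forall i, \sum_k w i k * y k = 0) ->
     \sum_k z k * y k = 0) ->
  exists n : I -> F, forall k, z k = \sum_i n i * w i k.
Proof.
move=> zP.
pose A := \matrix_(i < #|I|, k < N) w (enum_val i) k.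
pose Z := \row_(k < N) z k.
have : (Z <= A)%MS.
  rewrite submxE; apply/eqP/rowP=> j; rewrite !mxE.
  under eq_bigr do rewrite mxE.
  apply: zP => i; have /matrixP/(_ (enum_rank i) j) := mulmx_coker A.
  rewrite mxE [RHS]mxE => AE; rewrite -[RHS]AE; apply: eq_bigr => k _.
  by rewrite [A _ _]mxE enum_rankK.
case/submxP=> D ZE; exists (fun i => D ord0 (enum_rank i)) => k.
have /matrixP/(_ ord0 k) := ZE; rewrite !mxE => ->.
rewrite (reindex (@enum_rank I)) /=; last by apply: onW_bij; exact: enum_rank_bij.
by apply: eq_bigr => i _; rewrite mxE enum_rankK.
Qed.

End Duality.

Section Ideals.

Lemma in_generated_ideal_morph (R S : comNzRingType) (phi : {rmorphism R -> S})
    (I : finType) (A : {set I}) (g : I -> R) (f : R) :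
  (forall i, i \in A -> phi (g i) = 0) ->
  in_generated_ideal A g f -> phi f = 0.
Proof.
move=> gP [c ->]; rewrite rmorph_sum big1 // => i iA.
by rewrite rmorphM gP // mulr0.
Qed.

Variables (R : comNzRingType) (I : finType) (A : {set I}) (g : I -> R).
Local Notation ideal := (in_generated_ideal A g).

Lemma in_generated_ideal_gen i : i \in A -> ideal (g i).
Proof.
move=> iA; exists (fun j => (j == i)%:R); rewrite (bigD1 i) //= eqxx mul1r.
by rewrite big1 ?addr0 // => j /andP[_ /negPf->]; rewrite mul0r.
Qed.

Lemma in_generated_ideal0 : ideal 0.
Proof. by exists (fun=> 0); rewrite big1 // => i _; rewrite mul0r. Qed.

Lemma in_generated_idealD f1 f2 : ideal f1 -> ideal f2 -> ideal (f1 + f2).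
Proof.
move=> [c1 ->] [c2 ->]; exists (fun i => c1 i + c2 i).
by rewrite -big_split; apply: eq_bigr => i _; rewrite mulrDl.
Qed.

Lemma in_generated_idealM a f : ideal f -> ideal (a * f).
Proof.
move=> [c ->]; exists (fun i => a * c i).
by rewrite mulr_sumr; apply: eq_bigr => i _; rewrite mulrA.
Qed.

Lemma in_generated_idealN f : ideal f -> ideal (- f).
Proof. by move=> /(in_generated_idealM (-1)); rewrite mulN1r. Qed.

Lemma in_generated_idealB f1 f2 : ideal f1 -> ideal f2 -> ideal (f1 - f2).
Proof. by move=> h1 /in_generated_idealN; apply: in_generated_idealD. Qed.

Lemma in_generated_ideal_sum (J : eqType) (r : seq J) (F : J -> R) :
  (forall j, j \in r -> ideal (F j)) -> ideal (\sum_(j <- r) F j).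
Proof.
move=> FP; rewrite big_seq; apply: (big_ind ideal) => //.
- exact: in_generated_ideal0.
- exact: in_generated_idealD.
Qed.

End Ideals.

(** * Toric ideals as kernels of monomial substitutions *)

Section Toric.
Variable K : fieldType.

Lemma comp_mpoly_comp (k l d : nat) (lp : k.-tuple {mpoly K[l]})
    (lq : l.-tuple {mpoly K[d]}) (f : {mpoly K[k]}) :
  (f \mPo lp) \mPo lq = f \mPo [tuple tnth lp i \mPo lq | i < k].
Proof.
rewrite !(comp_mpolyE f) raddf_sum; apply: eq_bigr => u _ /=.
rewrite comp_mpolyZ rmorph_prod; congr (_ *: _); apply: eq_bigr => i _.
by rewrite rmorphXn /= tnth_mktuple.
Qed.

Lemma rename_varsK k l (s : 'I_k -> 'I_l) t : cancel s t ->
  cancel (@rename_vars K k l s) (@rename_vars K l k t).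
Proof.
move=> st f; rewrite /rename_vars comp_mpoly_comp -[RHS]comp_mpoly_id.
congr (comp_mpoly _ f); apply: eq_from_tnth => i; rewrite !tnth_mktuple.
by rewrite comp_mpolyXU -tnth_nth tnth_mktuple st.
Qed.

Variables (N d : nat) (e : 'I_N -> {set 'I_d}).

(** Its kernel is the toric ideal of the graph with the edges [e k]. *)
Definition edge_subst (f : {mpoly K[N]}) : {mpoly K[d]} :=
  f \mPo [tuple edge_monomial K (e k) | k < N].

(** The degrees at the vertices of the multigraph in which the edge [e k] occurs
    [u k] times, that is, the exponent of the image of the monomial [u]. *)
Definition vdeg (u : 'X_{1..N}) : 'X_{1..d} :=
  [multinom (\sum_(k < N) u k * (v \in e k))%N | v < d].

Lemma edge_substX u : edge_subst 'X_[u] = 'X_[vdeg u].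
Proof.
rewrite /edge_subst comp_mpolyX.
have eX k : edge_monomial K (e k) = 'X_[[multinom nat_of_bool (v \in e k) | v < d]].
  rewrite /edge_monomial mpolyXE_id big_mkcond; apply: eq_bigr => v _.
  by rewrite mnmE; case: (v \in e k).
under eq_bigr do rewrite tnth_mktuple eX mpolyXn.
rewrite mprodXE; congr 'X_[_]; apply/mnmP=> v; rewrite mnm_sumE mnmE.
by apply: eq_bigr => k _; rewrite mulmnE mnmE mulnC.
Qed.

Lemma edge_subst_binomial u w :
  edge_subst ('X_[u] - 'X_[w]) = 0 <-> vdeg u = vdeg w.
Proof.
rewrite /edge_subst raddfB /= -/(edge_subst _) -/(edge_subst _) !edge_substX.
split=> [/eqP|->]; last by rewrite subrr.
rewrite subr_eq0 => /eqP/mpolyP/(_ (vdeg u)); rewrite !mcoeffX eqxx.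
by case: eqP => // _ /eqP; rewrite oner_eq0.
Qed.

Lemma vdegD u w : vdeg (u + w) = (vdeg u + vdeg w)%MM.
Proof.
apply/mnmP=> v; rewrite mnmDE !mnmE -big_split; apply: eq_bigr => k _ /=.
by rewrite mnmDE mulnDl.
Qed.

Lemma vdegU k v : vdeg U_(k) v = (v \in e k) :> nat.
Proof.
rewrite mnmE (bigD1 k) //= mnm1E eqxx mul1n big1 ?addn0 // => j /negPf.
by rewrite mnm1E eq_sym => ->.
Qed.

End Toric.

(** Up to the names of its vertices, a graph is the family of its edges: pairwise
    distinct two-element sets, here indexed by the variables themselves. *)
Lemma toric_presentation (K : fieldType) (N : nat) (I : {mpoly K[N]} -> Prop) :
  (exists (d : nat) (G : sgraph d),
     equal_up_to_renaming I (@in_toric_ideal K d G)) <->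
  (exists (d : nat) (e : 'I_N -> {set 'I_d}),
     [/\ injective e, forall k, #|e k| = 2 &
         forall f, I f <-> edge_subst e f = 0]).
Proof.
have toric_rename d (G : sgraph d) (s : 'I_N -> 'I_#|edges G|) f :
    toric_map (rename_vars s f) = edge_subst (fun k => enum_val (s k)) f :> {mpoly K[d]}.
  rewrite /toric_map /rename_vars /edge_subst comp_mpoly_comp.
  congr (comp_mpoly _ f); apply: eq_from_tnth => i; rewrite !tnth_mktuple.
  by rewrite comp_mpolyXU -tnth_nth tnth_mktuple.
split=> [[d [G [s sbij JE]]]|[d [e [einj e2 IE]]]].
  have [t st ts] := sbij.
  exists d, (fun k => enum_val (s k)); split.
  - by move=> k l /enum_val_inj/(bij_inj sbij).
  - by move=> k; apply: (@edgesP _ G); apply: enum_valP.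
  - move=> f; rewrite -toric_rename; split=> [If|].
      by apply/JE; exists f.
    by case/JE=> f' If' /(can_inj (rename_varsK st)) <-.
have edgesE E : E \in [set e k | k in [set: 'I_N]] -> #|E| = 2.
  by case/imsetP=> k _ ->.
pose G := SGraph edgesE.
have eG k : e k \in edges G by apply: imset_f; rewrite inE.
pose s k : 'I_#|edges G| := enum_rank_in (eG k) (e k).
have sE k : enum_val (s k) = e k by apply: (enum_rankK_in (eG k)); exact: eG.
have sbij : bijective s.
  apply: inj_card_bij; last by rewrite !card_ord card_imset // cardsT card_ord.
  by move=> k l skl; apply: einj; rewrite -!sE skl.
have substE f : edge_subst e f = toric_map (rename_vars s f) :> {mpoly K[d]}.
  rewrite toric_rename; congr (comp_mpoly _ f).
  by apply: eq_from_tnth => i; rewrite !tnth_mktuple sE.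
exists d, G, s => // g; split=> [Jg|[f If <-]].
  have [t st ts] := sbij; exists (rename_vars t g).
    by apply/IE; rewrite substE rename_varsK.
  exact: rename_varsK.
by rewrite /in_toric_ideal -substE; apply/IE.
Qed.

(** If the fibres of [vdeg] are connected modulo an ideal, the ideal contains
    the kernel: substituting for every monomial a representative of its fibre
    factors through [edge_subst]. *)
Lemma ker_edge_subst_sub (K : fieldType) (N d : nat) (e : 'I_N -> {set 'I_d})
    (I : finType) (A : {set I}) (g : I -> {mpoly K[N]}) :
  (forall u w, vdeg e u = vdeg e w -> in_generated_ideal A g ('X_[u] - 'X_[w])) ->
  forall f, edge_subst e f = 0 -> in_generated_ideal A g f.
Proof.
move=> fibre f f0.
pose rep u := choose (fun w => vdeg e w == vdeg e u) u.
have repP u : vdeg e (rep u) = vdeg e u 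
    by apply/eqP; apply: (@chooseP _ (fun w => vdeg e w == vdeg e u)); exact: eqxx.
have repE u w : vdeg e u = vdeg e w -> rep u = rep w.
  move=> uw; rewrite /rep -uw; apply: choose_id => //.
  by rewrite uw.
have ->: f = \sum_(u <- msupp f) f@_u *: ('X_[u] - 'X_[rep u]).
  under eq_bigr do rewrite scalerBr; rewrite sumrB -mpolyE.
  suff ->: \sum_(u <- msupp f) f@_u *: 'X_[rep u] = 0 :> {mpoly K[N]} by rewrite subr0.
  apply/mpolyP=> w; rewrite mcoeff0 raddf_sum /=.
  under eq_bigr do rewrite mcoeffZ mcoeffX.
  have [wE|nw] := eqVneq (rep w) w; last first.
    apply: big1 => u _; case: eqP; rewrite ?mulr0 // => uw.
    by rewrite -uw (repE _ _ (repP u)) eqxx in nw.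
  have /mpolyP/(_ (vdeg e w)) := f0; rewrite mcoeff0 => f0w; rewrite -[RHS]f0w.
  rewrite /edge_subst comp_mpolyEX raddf_sum /=; apply: eq_bigr => u _.
  rewrite mcoeffZ -/(edge_subst e _) edge_substX mcoeffX.
  congr (_ * (nat_of_bool _)%:R); apply/eqP/eqP=> [<-|uw]; first by rewrite repP.
  by rewrite -wE; apply: repE.
apply: in_generated_ideal_sum => u _; rewrite -mul_mpolyC.
by apply/in_generated_idealM/fibre; rewrite repP.
Qed.

(** * Cells, blocks and the geometry of Gamma *)

Section Cells.
Variables m n : nat.
Implicit Types (c : 'I_(m * n)) (p q : minor_index m n).

Definition crow c : nat := (enum_val (cast_ord (esym (mxvec_cast m n)) c)).1.
Definition ccol c : nat := (enum_val (cast_ord (esym (mxvec_cast m n)) c)).2.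

Lemma crow_index (i : 'I_m) (j : 'I_n) : crow (mxvec_index i j) = i.
Proof. by rewrite /crow /mxvec_index cast_ordK enum_rankK. Qed.

Lemma ccol_index (i : 'I_m) (j : 'I_n) : ccol (mxvec_index i j) = j.
Proof. by rewrite /ccol /mxvec_index cast_ordK enum_rankK. Qed.

Lemma cell_inj c c' : crow c = crow c' -> ccol c = ccol c' -> c = c'.
Proof.
case/mxvec_indexP: c => i j; case/mxvec_indexP: c' => i' j'.
by rewrite !crow_index !ccol_index => /val_inj -> /val_inj ->.
Qed.

Lemma cell_eqE c c' : (c == c') = (crow c == crow c') && (ccol c == ccol c').
Proof.
apply/eqP/andP=> [->|[/eqP rE /eqP cE]]; first by rewrite !eqxx.
exact: cell_inj.
Qed.

Definition mrow q : nat := q.1.1.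
Definition mcol q : nat := q.2.1.

Definition nw q := mxvec_index q.1.1 q.2.1.
Definition ne q := mxvec_index q.1.1 q.2.2.
Definition sw q := mxvec_index q.1.2 q.2.1.
Definition se q := mxvec_index q.1.2 q.2.2.

Definition in_block q c : bool :=
  (mrow q <= crow c <= (mrow q).+1)%N && (mcol q <= ccol c <= (mcol q).+1)%N.

Lemma minor2E (K : fieldType) q :
  minor2 K q = 'X_(nw q) * 'X_(se q) - 'X_(ne q) * 'X_(sw q).
Proof. by case: q => [[a1 a2] [b1 b2]]; rewrite /minor2 !mxE. Qed.

Lemma crow_nw q : crow (nw q) = mrow q. Proof. exact: crow_index. Qed.
Lemma crow_ne q : crow (ne q) = mrow q. Proof. exact: crow_index. Qed.
Lemma ccol_nw q : ccol (nw q) = mcol q. Proof. exact: ccol_index. Qed.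
Lemma ccol_sw q : ccol (sw q) = mcol q. Proof. exact: ccol_index. Qed.

Section Adjacent.
Variables (q : minor_index m n) (adjq : adjacent q).

Lemma crow_sw : crow (sw q) = (mrow q).+1.
Proof. by move: adjq; case: (q) => [[a1 a2] [b1 b2]] /andP[/eqP E _]; rewrite crow_index. Qed.
Lemma crow_se : crow (se q) = (mrow q).+1.
Proof. by move: adjq; case: (q) => [[a1 a2] [b1 b2]] /andP[/eqP E _]; rewrite crow_index. Qed.
Lemma ccol_ne : ccol (ne q) = (mcol q).+1.
Proof. by move: adjq; case: (q) => [[a1 a2] [b1 b2]] /andP[_ /eqP E]; rewrite ccol_index. Qed.
Lemma ccol_se : ccol (se q) = (mcol q).+1.
Proof. by move: adjq; case: (q) => [[a1 a2] [b1 b2]] /andP[_ /eqP E]; rewrite ccol_index. Qed.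

Definition cornerE := (crow_nw, crow_ne, ccol_nw, ccol_sw, crow_sw, crow_se, ccol_ne, ccol_se).

Lemma in_blockP c :
  reflect [\/ c = nw q, c = ne q, c = sw q | c = se q] (in_block q c).
Proof.
apply: (iffP idP) => [|[] ->]; rewrite /in_block ?cornerE; try lia.
move=> H; have: (crow c = mrow q \/ crow c = (mrow q).+1) /\
   (ccol c = mcol q \/ ccol c = (mcol q).+1) by lia.
by case=> -[r|r] [k|k]; [constructor 1|constructor 2|constructor 3|constructor 4];
  apply: cell_inj; rewrite cornerE.
Qed.

Lemma mrow_lt : ((mrow q).+1 < m)%N.
Proof. by move: adjq; case: (q) => [[a1 a2] [b1 b2]] /andP[/eqP <- _]; apply: ltn_ord. Qed.
Lemma mcol_lt : ((mcol q).+1 < n)%N.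
Proof. by move: adjq; case: (q) => [[a1 a2] [b1 b2]] /andP[_ /eqP <-]; apply: ltn_ord. Qed.

End Adjacent.

Lemma adjacent_inj p q : adjacent p -> adjacent q ->
  mrow p = mrow q -> mcol p = mcol q -> p = q.
Proof.
case: p q => [[a1 a2] [b1 b2]] [[a1' a2'] [b1' b2']].
rewrite /adjacent /mrow /mcol /= => /andP[/eqP A /eqP B] /andP[/eqP A' /eqP B'] Ea Eb.
by congr ((_, _), (_, _)); apply: val_inj => /=; lia.
Qed.

End Cells.

Section Gamma.
Variables (m n : nat) (M : {set minor_index m n}).
Hypothesis adjM : forall q, q \in M -> adjacent q.
Implicit Types (c : 'I_(m * n)) (p q : minor_index m n).

(** Functions on the cells that satisfy every relation of M: the weights for
    which the generators are homogeneous. *)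
Definition balanced (V : zmodType) (y : 'I_(m * n) -> V) : Prop :=
  forall q, q \in M -> y (nw q) + y (se q) = y (ne q) + y (sw q).

Lemma Gamma_sym : ssrbool.symmetric (Gamma M).
Proof.
move=> p q; rewrite /Gamma andbCA eq_sym.
by rewrite [minor_rows _ :&: _]setIC [minor_cols _ :&: _]setIC.
Qed.

Lemma Gamma_irr : irreflexive (Gamma M).
Proof. by move=> p; rewrite /Gamma eqxx !andbF. Qed.

Lemma Gamma_near p q : p \in M -> q \in M -> p != q ->
  (mrow p <= (mrow q).+1)%N -> (mrow q <= (mrow p).+1)%N ->
  (mcol p <= (mcol q).+1)%N -> (mcol q <= (mcol p).+1)%N -> Gamma M p q.
Proof.
move=> pM qM pq r1 r2 c1 c2; rewrite /Gamma pM qM pq /=.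
move: (adjM pM) (adjM qM) r1 r2 c1 c2; rewrite /adjacent /mrow /mcol /minor_rows /minor_cols.
case: (p) (q) => [[a1 a2] [b1 b2]] [[a1' a2'] [b1' b2']] /=.
move=> /andP[/eqP A /eqP B] /andP[/eqP A' /eqP B'] r1 r2 c1 c2.
have inter k (x y x' y' : 'I_k) : x.+1 = y -> x'.+1 = y' ->
    (x <= x'.+1)%N -> (x' <= x.+1)%N -> [set x; y] :&: [set x'; y'] != set0.
  move=> E E' l l'; apply/set0Pn.
  have: [\/ x = x', x = y' | y = x'].
    have: [\/ x = x' :> nat, x = y' :> nat | y = x' :> nat].
      by case: (ltngtP x x') => ?; [constructor 3|constructor 2|constructor 1]; lia.
    by case=> /val_inj; [constructor 1|constructor 2|constructor 3].
  case=> Ex; [exists x|exists x|exists y]; rewrite !inE Ex ?eqxx ?orbT //.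
by rewrite !inter.
Qed.

Lemma Gamma_bounds p q : Gamma M p q ->
  [/\ p \in M, q \in M, p != q,
      (mrow p <= (mrow q).+1)%N && (mrow q <= (mrow p).+1)%N &
      (mcol p <= (mcol q).+1)%N && (mcol q <= (mcol p).+1)%N].
Proof.
case/and5P=> pM qM pq; move: (adjM pM) (adjM qM).
rewrite pM qM pq /adjacent /mrow /mcol /minor_rows /minor_cols.
case: (p) (q) => [[a1 a2] [b1 b2]] [[a1' a2'] [b1' b2']] /=.
move=> /andP[/eqP A /eqP B] /andP[/eqP A' /eqP B'].
move=> /set0Pn[x]; rewrite !inE => /andP[rx rx'] /set0Pn[y].
rewrite !inE => /andP[cy cy']; split=> //.
- by move: rx rx' => /orP[]/eqP xE /orP[]/eqP xE'; subst x; rewrite ?xE' in A A' *; lia.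
- by move: cy cy' => /orP[]/eqP xE /orP[]/eqP xE'; subst y; rewrite ?xE' in B B' *; lia.
Qed.

Lemma Gamma_share p q c : p \in M -> q \in M -> p != q ->
  in_block p c -> in_block q c -> Gamma M p q.
Proof. by rewrite /in_block => pM qM pq pc qc; apply: Gamma_near => //; lia. Qed.

Hypothesis chess : chessboard M.

Lemma chess_row p q : p \in M -> q \in M -> mrow p = mrow q ->
  mcol q = (mcol p).+1 -> False.
Proof.
move=> pM qM Er Ec; have [/(_ p q pM qM) H _] := chess.
move: (adjM pM) (adjM qM) H Er Ec; rewrite /adjacent /mrow /mcol.
case: (p) (q) => [[a1 a2] [b1 b2]] [[a1' a2'] [b1' b2']] /=.
move=> /andP[/eqP A /eqP B] /andP[/eqP A' /eqP B'] H Er Ec.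
have Ea : (a1, a2) = (a1', a2') by congr (_, _); apply: val_inj => /=; lia.
by have := H Ea; lia.
Qed.

Lemma chess_col p q : p \in M -> q \in M -> mcol p = mcol q ->
  mrow q = (mrow p).+1 -> False.
Proof.
move=> pM qM Ec Er; have [_ /(_ p q pM qM) H] := chess.
move: (adjM pM) (adjM qM) H Er Ec; rewrite /adjacent /mrow /mcol.
case: (p) (q) => [[a1 a2] [b1 b2]] [[a1' a2'] [b1' b2']] /=.
move=> /andP[/eqP A /eqP B] /andP[/eqP A' /eqP B'] H Er Ec.
have Eb : (b1, b2) = (b1', b2') by congr (_, _); apply: val_inj => /=; lia.
by have := H Eb; lia.
Qed.

(** On a chessboard, two blocks that meet share a single corner: anything more
    would put two minors in the same rows or columns next to each other. *)
Lemma Gamma_diag p q : Gamma M p q ->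
  (mrow q = (mrow p).+1 \/ mrow p = (mrow q).+1) /\
  (mcol q = (mcol p).+1 \/ mcol p = (mcol q).+1).
Proof.
move=> g; have [pM qM pq r k] := Gamma_bounds g.
have nr : mrow p <> mrow q.
  move=> E; have [E'|] := eqVneq (mcol p) (mcol q).
    by move/eqP: pq; apply; apply: adjacent_inj (adjM pM) (adjM qM) E E'.
  move=> nc; have [Ec|Ec] : mcol q = (mcol p).+1 \/ mcol p = (mcol q).+1 by lia.
    exact: chess_row pM qM E Ec.
  exact: chess_row qM pM (esym E) Ec.
have nc : mcol p <> mcol q.
  move=> E; have [Er|Er] : mrow q = (mrow p).+1 \/ mrow p = (mrow q).+1 by lia.
    exact: chess_col pM qM E Er.
  exact: chess_col qM pM (esym E) Er.
by lia.
Qed.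

Lemma Gamma_corner p q : Gamma M p q -> exists2 c, in_block p c & in_block q c.
Proof.
move=> g; have [pM qM _ r k] := Gamma_bounds g.
have [d1 d2] := Gamma_diag g.
have rb := mrow_lt (adjM pM); have cb := mcol_lt (adjM pM).
have rb' := mrow_lt (adjM qM); have cb' := mcol_lt (adjM qM).
have i_lt : (maxn (mrow p) (mrow q) < m)%N by lia.
have j_lt : (maxn (mcol p) (mcol q) < n)%N by lia.
exists (mxvec_index (Ordinal i_lt) (Ordinal j_lt)).
all: by rewrite /in_block crow_index ccol_index /=; lia.
Qed.

Lemma Gamma_corner_uniq p q c c' : Gamma M p q -> in_block p c -> in_block q c ->
  in_block p c' -> in_block q c' -> c = c'.
Proof.
move=> /Gamma_diag [d1 d2]; rewrite /in_block => *; apply: cell_inj; lia.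
Qed.

Lemma Gamma_corner_max p q c : Gamma M p q -> in_block p c -> in_block q c ->
  crow c = maxn (mrow p) (mrow q) /\ ccol c = maxn (mcol p) (mcol q).
Proof. by move=> /Gamma_diag [d1 d2]; rewrite /in_block => *; split; lia. Qed.

Lemma block_pair_uniq p q r c : p \in M -> q \in M -> r \in M -> p != q -> p != r ->
  in_block p c -> in_block q c -> in_block r c -> q = r.
Proof.
move=> pM qM rM pq pr pc qc rc.
have [d1 d2] := Gamma_diag (Gamma_share pM qM pq pc qc).
have [d3 d4] := Gamma_diag (Gamma_share pM rM pr pc rc).
by move: pc qc rc; rewrite /in_block => *; apply: adjacent_inj; rewrite ?adjM //; lia.
Qed.

Hypothesis no4 : no_cycle_of_length (Gamma M) 4.

Lemma Gamma_no_square p q r t : Gamma M p q -> Gamma M q r -> Gamma M r t ->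
  Gamma M t p -> p != r -> q != t -> False.
Proof.
move=> pq qr rt tp pr qt; apply: (no4 (s := [:: p; q; r; t])) => //.
have ne a b : Gamma M a b -> a != b by case/and5P.
rewrite /graph_cycle /ucycleb /= pq qr rt tp /= !inE !negb_or pr qt.
by rewrite (ne _ _ pq) (ne _ _ qr) (ne _ _ rt) eq_sym (ne _ _ tp).
Qed.

(** Two Gamma-steps x -> y -> z form a right angle iff their sum is a horizontal
    or a vertical move. *)
Definition turn (x z : minor_index m n) : bool := (mrow x == mrow z) (+) (mcol x == mcol z).

Lemma turn_neq x z : turn x z -> x != z.
Proof. by apply: contraTneq => ->; rewrite /turn !eqxx. Qed.

Lemma turnP x z : turn x z ->
  (mrow x = mrow z /\ mcol x <> mcol z) \/ (mrow x <> mrow z /\ mcol x = mcol z).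
Proof.
rewrite /turn; case: (eqVneq (mrow x) (mrow z)) => [Er|/eqP Er];
  by case: (eqVneq (mcol x) (mcol z)) => [Ec|/eqP Ec] //= _; first [by left | by right].
Qed.

Lemma straight_line x y z : Gamma M x y -> Gamma M y z -> x != z -> ~~ turn x z ->
  (mrow x + mrow z = (mrow y).*2)%N /\ (mcol x + mcol z = (mcol y).*2)%N.
Proof.
move=> gxy gyz xz; rewrite /turn.
have [xM _ _ _ _] := Gamma_bounds gxy; have [_ zM _ _ _] := Gamma_bounds gyz.
have [d1 d2] := Gamma_diag gxy; have [d3 d4] := Gamma_diag gyz.
case: (eqVneq (mrow x) (mrow z)) => Er; case: (eqVneq (mcol x) (mcol z)) => Ec //= _.
  by case/eqP: xz; apply: adjacent_inj Er Ec; apply: adjM.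
by lia.
Qed.

(** A walk in Gamma that turns at every step is a staircase: two consecutive
    turns to the same side would close up to a cycle of length 4.  A staircase
    moves on forever in one horizontal or vertical direction, so it cannot stay
    in a finite board. *)
Lemma no_endless_staircase (S : minor_index m n -> minor_index m n -> Prop) :
  (forall x y, S x y -> Gamma M x y) ->
  (forall x y, S x y -> exists2 z, S y z & turn x z) ->
  forall x y, S x y -> False.
Proof.
move=> SG Sturn.
have step x y z : S x y -> S y z -> turn x z -> exists t,
    [/\ S z t, turn y t, (mrow t + mrow x = mrow z + mrow y)%N &
        (mcol t + mcol x = mcol z + mcol y)%N].
  move=> xy yz txz; have [t zt tyt] := Sturn _ _ yz; exists t.
  have [[gxy gyz] gzt] := (SG _ _ xy, SG _ _ yz, SG _ _ zt).
  have [xM yM _ _ _] := Gamma_bounds gxy; have [zM tM _ _ _] := Gamma_bounds gzt.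
  have [d1 d2] := Gamma_diag gxy; have [d3 d4] := Gamma_diag gyz.
  have [d5 d6] := Gamma_diag gzt.
  have [Er|Er] := boolP ((mrow t + mrow x == mrow z + mrow y)%N &&
       (mcol t + mcol x == mcol z + mcol y)%N).
    by case/andP: Er => /eqP E1 /eqP E2.
  (* the walk turned back, so that t is next to x and x, y, z, t form a square *)
  have xt : x != t by apply/eqP=> E; subst t; move: txz tyt; rewrite /turn; lia.
  case: (@Gamma_no_square x y z t); rewrite ?turn_neq //.
  have [e1 e2] : (mrow t + mrow y = mrow z + mrow x)%N /\
      (mcol t + mcol y = mcol z + mcol x)%N.
    move: (turnP txz) (turnP tyt) Er; clear -d1 d2 d3 d4 d5 d6.
    move=> [[a b]|[a b]] [[a' b']|[a' b']] /negP Er.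
    - by case: Er; apply/andP; split; apply/eqP; lia.
    - by split; clear Er; lia.
    - by split; clear Er; lia.
    - by case: Er; apply/andP; split; apply/eqP; lia.
  by apply: Gamma_near; rewrite 1?eq_sym //; clear -e1 e2 d3 d4; lia.
move=> x0 y0 S0; have [z0 S1 t0] := Sturn _ _ S0.
(* every double step is the translate of the first one, from x0 to z0 *)
pose far (k : nat) (x z : minor_index m n) := [/\
  (mrow x + k * mrow x0 = mrow x0 + k * mrow z0)%N,
  (mcol x + k * mcol x0 = mcol x0 + k * mcol z0)%N,
  (mrow z + mrow x0 = mrow x + mrow z0)%N & (mcol z + mcol x0 = mcol x + mcol z0)%N].
have iter_step k : exists x y z, [/\ S x y, S y z, turn x z & far k x z].
  elim: k => [|k [x [y [z [xy yz txz [f1 f2 f3 f4]]]]]].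
    by exists x0, y0, z0; split=> //; split; lia.
  have [t [zt tyt e1 e2]] := step _ _ _ xy yz txz.
  have [w [tw tzw e3 e4]] := step _ _ _ yz zt tyt.
  by exists z, t, w; split=> //; split; lia.
have [x [y [z [xy yz _ [f1 f2 _ _]]]]] := iter_step (m + n).+1.
have bound u v : S u v -> ((mrow u).+1 < m)%N /\ ((mcol u).+1 < n)%N.
  by move=> /SG/Gamma_bounds[/adjM uM _ _ _ _]; rewrite mrow_lt ?mcol_lt.
have [b1 b2] := bound _ _ xy; have [b3 b4] := bound _ _ S0.
have [d1 d2] := Gamma_diag (SG _ _ S0); have [d3 d4] := Gamma_diag (SG _ _ S1).
have: [\/ mrow z0 = (mrow x0).+2, mrow x0 = (mrow z0).+2,
          mcol z0 = (mcol x0).+2 | mcol x0 = (mcol z0).+2].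
  have: (mrow z0 = (mrow x0).+2 \/ mrow x0 = (mrow z0).+2) \/
     (mcol z0 = (mcol x0).+2 \/ mcol x0 = (mcol z0).+2) by move: t0; rewrite /turn; lia.
  by case=> -[]; [constructor 1|constructor 2|constructor 3|constructor 4].
by case=> E; rewrite E in f1 f2; nia.
Qed.

End Gamma.

Ltac lia_degrees :=
  repeat match goal with
    |- context[fun_of_multinom ?u ?v] => generalize (fun_of_multinom u v)
  end;
  clear; intros; lia.

(** * Necessity: chessboard type and no cycle of length 4 *)

Section CommonDenominator.

Lemma common_denominator (N : nat) (z : 'I_N -> rat) :
  exists B : int, B != 0 /\
    exists g : 'I_N -> int, forall k, z k * B%:~R = (g k)%:~R.
Proof.
exists (\prod_k denq (z k)); split.
  by apply/prodf_neq0 => k _; rewrite denq_eq0.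
exists (fun k => numq (z k) * \prod_(j | j != k) denq (z j)) => k.
rewrite (bigD1 k) //= !intrM mulrA; congr (_ * _).
by rewrite -{1}(divq_num_den (z k)) divfK // intr_eq0 denq_eq0.
Qed.

Lemma int_pos_neg (g : int) :
  ((if 0 <= g then `|g|%N else 0%N)%:Z - (if 0 <= g then 0%N else `|g|%N)%:Z = g)%R.
Proof. by case: ifP => g0; lia. Qed.

End CommonDenominator.

Lemma mnm1_neq0 N (i k : 'I_N) : U_(i)%MM k != 0%N -> k = i.
Proof. by rewrite mnm1E; case: (eqVneq i k). Qed.

Section Necessity.
Variables (K : fieldType) (m n : nat) (M : {set minor_index m n}).
Hypothesis adjM : forall q, q \in M -> adjacent q.
Local Notation cell := 'I_(m * n).

Variables (d : nat) (e : cell -> {set 'I_d}).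
Hypothesis IE : forall f : {mpoly K[m * n]}, in_minor_ideal M f <-> edge_subst e f = 0.

Lemma fibre_in_ideal u w : vdeg e u = vdeg e w <->
  in_minor_ideal M ('X_[u] - 'X_[w] : {mpoly K[m * n]}).
Proof. by rewrite IE edge_subst_binomial. Qed.

Lemma block_vdeg q v : q \in M ->
  (vdeg e U_(nw q) v + vdeg e U_(se q) v = vdeg e U_(ne q) v + vdeg e U_(sw q) v)%N.
Proof.
move=> qM.
have /fibre_in_ideal/mnmP/(_ v) : in_minor_ideal M
   ('X_[U_(nw q) + U_(se q)] - 'X_[U_(ne q) + U_(sw q)] : {mpoly K[m * n]}).
  rewrite !mpolyXD -minor2E; exact: in_generated_ideal_gen.
by rewrite !vdegD !mnmDE.
Qed.

Lemma block_degree q v : q \in M ->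
  ((v \in e (nw q)) + (v \in e (se q)) = (v \in e (ne q)) + (v \in e (sw q)))%N.
Proof. by move/(block_vdeg v); rewrite !vdegU. Qed.

(** A binomial is not in the ideal if the indicator function of [X] is a common
    zero of the minors but not of the binomial. *)
Lemma sparse_fibre (X : {set cell}) (u w : 'X_{1..m * n}) :
  (forall q, q \in M -> ~~ ((nw q \in X) && (se q \in X))) ->
  (forall q, q \in M -> ~~ ((ne q \in X) && (sw q \in X))) ->
  (forall k, u k != 0%N -> k \in X) -> (exists2 k, w k != 0%N & k \notin X) ->
  vdeg e u <> vdeg e w.
Proof.
move=> X1 X2 uX [k wk kX] /fibre_in_ideal H.
pose pt k : K := (k \in X)%:R.
have := in_generated_ideal_morph (phi := meval pt) _ H.
have w0 : \prod_i pt i ^+ w i = 0.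
  by rewrite (bigD1 k) //= /pt (negPf kX) expr0n (negPf wk) mul0r.
have u1 : \prod_i pt i ^+ u i = 1.
  apply: big1 => j _; rewrite /pt.
  by case: (eqVneq (u j) 0%N) => [->|/uX ->]; rewrite ?expr0 ?expr1n.
rewrite /= mevalB !mevalX u1 w0 subr0.
move=> H1; suff /eqP : (1 : K) = 0 by rewrite oner_eq0.
apply: H1 => q qM; rewrite minor2E mevalB !mevalM !mevalXU -!natrM !mulnb.
by rewrite (negPf (X1 q qM)) (negPf (X2 q qM)) subrr.
Qed.

(** Two minors with a common side: cancelling the common cells in the two
    relations leaves the minor of the outer columns (or rows), which is in the
    kernel; but no adjacent minor contains its first term. *)
Lemma toric_chessboard : chessboard M.
Proof.
split=> p q pM qM Epq lt_pq; rewrite ltnNge; apply/negP=> le_qp.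
- have [Ap Aq] := (adjM pM, adjM qM).
  have Er : mrow p = mrow q by rewrite /mrow Epq.
  have Ec : mcol q = (mcol p).+1.
    move: Ap lt_pq le_qp; rewrite /mcol /adjacent.
    by case: (p) (q) => [[a1 a2] [b1 b2]] [[? ?] [? ?]] /= /andP[_ /eqP ?]; lia.
  have E1 : ne p = nw q by apply: cell_inj; rewrite !cornerE //.
  have E2 : se p = sw q by apply: cell_inj; rewrite !cornerE //; lia.
  apply: (@sparse_fibre [set nw p; se q] (U_(nw p) + U_(se q)) (U_(ne q) + U_(sw p))).
  + move=> r rM; rewrite !inE !cell_eqE !cornerE ?adjM //; lia.
  + move=> r rM; rewrite !inE !cell_eqE !cornerE ?adjM //; lia.
  + move=> k; rewrite mnmDE addn_eq0 negb_and.
    by case/orP=> /mnm1_neq0 ->; rewrite !inE eqxx ?orbT.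
  + exists (sw p); first by rewrite mnmDE !mnm1E eqxx addn1.
    by rewrite !inE !cell_eqE !cornerE //; lia.
  + apply/mnmP=> v; rewrite !vdegD !mnmDE.
    have := block_vdeg v pM; have := block_vdeg v qM.
    rewrite E1 E2; lia_degrees.
- have [Ap Aq] := (adjM pM, adjM qM).
  have Ec : mcol p = mcol q by rewrite /mcol Epq.
  have Er : mrow q = (mrow p).+1.
    move: Ap lt_pq le_qp; rewrite /mrow /adjacent.
    by case: (p) (q) => [[a1 a2] [b1 b2]] [[? ?] [? ?]] /= /andP[/eqP ? _]; lia.
  have E1 : sw p = nw q by apply: cell_inj; rewrite !cornerE //.
  have E2 : se p = ne q by apply: cell_inj; rewrite !cornerE //; lia.
  apply: (@sparse_fibre [set nw p; se q] (U_(nw p) + U_(se q)) (U_(ne p) + U_(sw q))).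
  + move=> r rM; rewrite !inE !cell_eqE !cornerE ?adjM //; lia.
  + move=> r rM; rewrite !inE !cell_eqE !cornerE ?adjM //; lia.
  + move=> k; rewrite mnmDE addn_eq0 negb_and.
    by case/orP=> /mnm1_neq0 ->; rewrite !inE eqxx ?orbT.
  + exists (ne p); first by rewrite mnmDE !mnm1E eqxx add1n.
    by rewrite !inE !cell_eqE !cornerE //; lia.
  + apply/mnmP=> v; rewrite !vdegD !mnmDE.
    have := block_vdeg v pM; have := block_vdeg v qM.
    rewrite E1 E2; lia_degrees.
Qed.

(** In a cycle of length 4 the relations of N, W, E and S cancel on the central
    block and leave a binomial of degree 4 in the outer cells; no two cells of
    its first term are diagonal neighbours. *)
Lemma toric_no_square a b N W E S : N \in M -> W \in M -> E \in M -> S \in M ->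
  mrow N = a -> mcol N = b.+1 -> mrow W = a.+1 -> mcol W = b ->
  mrow E = a.+1 -> mcol E = b.+2 -> mrow S = a.+2 -> mcol S = b.+1 -> False.
Proof.
move=> NM WM EM SM rN cN rW cW rE cE rS cS.
have [[AN AW] [AE AS]] := (adjM NM, adjM WM, (adjM EM, adjM SM)).
have E1 : sw N = ne W by apply: cell_inj; rewrite !cornerE //; lia.
have E2 : se N = nw E by apply: cell_inj; rewrite !cornerE //; lia.
have E3 : se W = nw S by apply: cell_inj; rewrite !cornerE //; lia.
have E4 : sw E = ne S by apply: cell_inj; rewrite !cornerE //; lia.
apply: (@sparse_fibre [set nw N; sw W; se S; ne E]
   (U_(nw N) + U_(sw W) + (U_(se S) + U_(ne E)))
   (U_(ne N) + U_(nw W) + (U_(se E) + U_(sw S)))).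
- by move=> r rM; rewrite !inE !cell_eqE !cornerE ?adjM // rN cN rW cW rE cE rS cS; lia.
- by move=> r rM; rewrite !inE !cell_eqE !cornerE ?adjM // rN cN rW cW rE cE rS cS; lia.
- move=> k; rewrite !mnmDE !addn_eq0 !negb_and.
  by case/orP=> /orP[] /mnm1_neq0 ->; rewrite !inE eqxx ?orbT.
- exists (ne N); first by rewrite !mnmDE !mnm1E eqxx !add1n.
  by rewrite !inE !cell_eqE !cornerE // rN cN rW cW rE cE rS cS; lia.
- apply/mnmP=> v; rewrite !vdegD !mnmDE.
  have := block_vdeg v NM; have := block_vdeg v WM.
  have := block_vdeg v EM; have := block_vdeg v SM.
  rewrite E1 E2 E3 E4; lia_degrees.
Qed.

(** The starting point and the direction of the cycle make eight cases. *)
Lemma toric_no_4cycle : no_cycle_of_length (Gamma M) 4.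
Proof.
move=> [|p [|q [|r [|t []]]]] // /and3P[_ cyc un] _.
move: cyc un => /=.
move=> /and5P[gpq gqr grt gtp _]; rewrite !inE !negb_or.
move=> /and4P[/and3P[_ pr _] /andP[_ qt] _ _].
have chess := toric_chessboard.
have [pM qM _ _ _] := Gamma_bounds adjM gpq.
have [rM tM _ _ _] := Gamma_bounds adjM grt.
have [a1 b1] := Gamma_diag adjM chess gpq; have [a2 b2] := Gamma_diag adjM chess gqr.
have [a3 b3] := Gamma_diag adjM chess grt; have [a4 b4] := Gamma_diag adjM chess gtp.
have neq u v : u \in M -> v \in M -> u != v -> mrow u <> mrow v \/ mcol u <> mcol v.
  move=> uM vM /eqP uv; case: (eqVneq (mrow u) (mrow v)) => [E|/eqP]; last by left.
  by right=> E'; apply: uv; apply: adjacent_inj E E'; apply: adjM.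
have {}pr := neq _ _ pM rM pr; have {neq}qt := neq _ _ qM tM qt.
have sq N W E S := @toric_no_square (mrow N) (mcol W) N W E S.
case: a1 => a1; case: a4 => a4; case: b1 => b1.
- by apply: (sq t p r q) => //; clear -pr qt a1 a2 a3 a4 b1 b2 b3 b4; lia.
- by apply: (sq t r p q) => //; clear -pr qt a1 a2 a3 a4 b1 b2 b3 b4; lia.
- by apply: (sq p t q r) => //; clear -pr qt a1 a2 a3 a4 b1 b2 b3 b4; lia.
- by apply: (sq p q t r) => //; clear -pr qt a1 a2 a3 a4 b1 b2 b3 b4; lia.
- by apply: (sq r t q p) => //; clear -pr qt a1 a2 a3 a4 b1 b2 b3 b4; lia.
- by apply: (sq r q t p) => //; clear -pr qt a1 a2 a3 a4 b1 b2 b3 b4; lia.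
- by apply: (sq q p r t) => //; clear -pr qt a1 a2 a3 a4 b1 b2 b3 b4; lia.
- by apply: (sq q r p t) => //; clear -pr qt a1 a2 a3 a4 b1 b2 b3 b4; lia.
Qed.

End Necessity.

Lemma Posz_sum (I : finType) (F : I -> nat) :
  Posz (\sum_i F i)%N = \sum_i Posz (F i).
Proof. by rewrite -natz natr_sum; apply: eq_bigr => i _; rewrite natz. Qed.

(** * Weights and the 4-cycles of the minors *)

Section Weights.
Variables (K : fieldType) (m n : nat) (M : {set minor_index m n}).
Hypothesis adjM : forall q, q \in M -> adjacent q.
Local Notation cell := 'I_(m * n).
Variables (d : nat) (e : cell -> {set 'I_d}).
Hypothesis einj : injective e.
Hypothesis e2 : forall k, #|e k| = 2.
Hypothesis IE : forall f : {mpoly K[m * n]}, in_minor_ideal M f <-> edge_subst e f = 0.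

(** The substitution of T^(y c) for x_c kills the minors. *)
Lemma weight_fibre (y : cell -> nat) (u w : 'X_{1..m * n}) :
  (forall q, q \in M -> (y (nw q) + y (se q) = y (ne q) + y (sw q))%N) ->
  vdeg e u = vdeg e w -> (\sum_k u k * y k = \sum_k w k * y k)%N.
Proof.
move=> ybal /(fibre_in_ideal IE) H.
pose phi : {rmorphism {mpoly K[m * n]} -> {poly K}} :=
  mmap (@polyC K) (fun k => 'X^(y k)).
have phiX x : phi 'X_[x] = 'X^(\sum_k x k * y k).
  rewrite /phi /= mmapX /mmap1 expr_sum; apply: eq_bigr => k _.
  by rewrite [(x k * _)%N]mulnC exprM.
have phiXU k : phi 'X_k = 'X^(y k) by rewrite /phi /= mmapX mmap1U.
have : phi ('X_[u] - 'X_[w]) = 0.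
  apply: in_generated_ideal_morph H => q qM; rewrite minor2E rmorphB /= .
  by rewrite !rmorphM /= !phiXU -!exprD ybal // subrr.
rewrite rmorphB /= !phiX => /eqP; rewrite subr_eq0 => /eqP/(congr1 (size \o val)) /=.
by rewrite !size_polyXn => -[].
Qed.

Lemma int_weight_fibre (y : cell -> int) (u w : 'X_{1..m * n}) :
  balanced M y -> vdeg e u = vdeg e w ->
  \sum_k (u k)%:Z * y k = \sum_k (w k)%:Z * y k.
Proof.
move=> ybal uw.
(* the two monomials have the same degree, so a constant may be added to y *)
have [B By] : exists B : nat, forall k, 0 <= y k + B%:Z.
  exists (\sum_k `|y k|)%N => k.
  have : (`|y k| <= \sum_k `|y k|)%N by rewrite (bigD1 k) //= leq_addr.
  lia.
have H1 := @weight_fibre (fun=> 1%N) u w (fun _ _ => erefl) uw.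
have ybal' q : q \in M -> (absz (y (nw q) + B%:Z)%R + absz (y (se q) + B%:Z)%R =
    absz (y (ne q) + B%:Z)%R + absz (y (sw q) + B%:Z)%R)%N.
  move=> qM; have := ybal q qM.
  by have := By (nw q); have := By (se q); have := By (ne q); have := By (sw q); lia.
have /(congr1 Posz) := @weight_fibre (fun k => absz (y k + B%:Z)%R) u w ybal' uw.
have E x : Posz (\sum_k x k * absz (y k + B%:Z)%R)%N =
    \sum_k (x k)%:Z * y k + B%:Z * (\sum_k x k * 1)%N%:Z.
  rewrite !Posz_sum mulr_sumr -big_split; apply: eq_bigr => k _ /=.
  by rewrite muln1 PoszM gez0_abs // mulrDr [B%:Z * _]mulrC.
by rewrite !E H1 => /addIr.
Qed.

(** By duality it suffices that [y] is orthogonal to the vectors that vanish at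
    every vertex of G; up to a denominator such a vector is a difference of two
    monomials in the same fibre, and these have the same weight. *)
Lemma balanced_vertex_potential (y : cell -> int) : balanced M y ->
  exists a : 'I_d -> rat, forall k, (y k)%:~R = \sum_(v in e k) a v.
Proof.
move=> ybal.
have [|a aE] := @orthogonal_span rat 'I_d (m * n)
    (fun v k => (v \in e k)%:R) (fun k => (y k)%:~R); last first.
  exists a => k; rewrite aE [RHS]big_mkcond; apply: eq_bigr => v _.
  by case: ifP; rewrite ?mulr1 ?mulr0.
move=> z zE; have [B [B0 [g gE]]] := common_denominator z.
pose u : 'X_{1..m * n} := [multinom (if (0 <= g k)%R then `|g k|%N else 0%N) | k < m * n].
pose w : 'X_{1..m * n} := [multinom (if (0 <= g k)%R then 0%N else `|g k|%N) | k < m * n].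
have uw k : (u k)%:Z - (w k)%:Z = g k by rewrite !mnmE int_pos_neg.
have B0' : B%:~R != 0 :> rat by rewrite intr_eq0.
have fibre : vdeg e u = vdeg e w.
  apply/mnmP=> v; rewrite [LHS]mnmE [RHS]mnmE; apply/eqP.
  rewrite -eqz_nat -subr_eq0 !Posz_sum -sumrB -(intr_eq0 rat) rmorph_sum /=.
  apply/eqP; transitivity (B%:~R * \sum_k (v \in e k)%:R * z k); last by rewrite zE mulr0.
  rewrite mulr_sumr; apply: eq_bigr => k _.
  rewrite !PoszM -mulrBl uw intrM -gE [z k * _]mulrC -mulrA; congr (_ * _).
  by rewrite mulrC; case: (v \in e k).
have H := int_weight_fibre ybal fibre.
apply: (mulIf B0'); rewrite mul0r mulr_suml.
transitivity ((\sum_k g k * y k)%:~R : rat).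
  by rewrite rmorph_sum; apply: eq_bigr => k _ /=; rewrite -mulrA gE mulrC -intrM.
under eq_bigr do rewrite -uw mulrBl; rewrite sumrB.
by rewrite H subrr.
Qed.

(** The four cells of a minor form a 4-cycle of G in which the two terms of the
    minor are the two pairs of opposite edges: T and B are the common vertices
    of the top and of the bottom cells, L and R of the left and right cells. *)
Lemma block_shape q : q \in M -> exists T L B R, [/\ uniq [:: T; L; B; R],
  e (nw q) = [set T; L], e (ne q) = [set T; R], e (sw q) = [set B; L] &
  e (se q) = [set B; R]].
Proof.
move=> qM; have deg v := block_degree IE v qM.
have Aq := adjM qM.
have ne1 : e (nw q) != e (ne q).
  by rewrite (inj_eq einj) cell_eqE !cornerE //; lia.
have ne2 : e (nw q) != e (sw q).
  by rewrite (inj_eq einj) cell_eqE !cornerE //; lia.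
move: deg ne1 ne2 (e2 (nw q)) (e2 (ne q)) (e2 (sw q)) (e2 (se q)).
move: (e (nw q)) (e (se q)) (e (ne q)) (e (sw q)) => A D C E deg AC AE A2 C2 E2 D2.
have sub (X Y : {set 'I_d}) x y : #|Y| = 2 -> X = [set x; y] -> x != y ->
    x \in Y -> y \in Y -> X = Y.
  move=> Y2 XE xy xY yY; apply/eqP; rewrite eqEcard Y2 XE cards2 xy andbT.
  by apply/subsetP=> z; rewrite !inE => /orP[] /eqP ->.
have other (Y : {set 'I_d}) x : #|Y| = 2 -> x \in Y ->
    exists z, [/\ Y = [set x; z], x != z & z \in Y].
  move=> /eqP/cards2P[a [b [ab ->]]]; rewrite !inE => /orP[] /eqP ->.
    by exists b; split=> //; rewrite !inE eqxx orbT.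
  by exists a; rewrite setUC eq_sym; split=> //; rewrite !inE eqxx ?orbT.
have [T [L [TL AEq TC LE]]] : exists T L, [/\ T != L, A = [set T; L], T \in C & L \in E].
  have /cards2P[x [y [xy AEq]]] : #|A| == 2 by rewrite A2.
  have cover z : z \in A -> (z \in C) || (z \in E).
    by move=> zA; move: (deg z); rewrite zA; do 3!case: (_ \in _).
  have xA : x \in A by rewrite AEq !inE eqxx.
  have yA : y \in A by rewrite AEq !inE eqxx orbT.
  have [xC|nxC] := boolP (x \in C).
    exists x, y; split=> //; case/orP: (cover y yA) => // yC.
    by rewrite (sub A C x y) ?eqxx in AC.
  have xE : x \in E by move: (cover x xA); rewrite (negPf nxC).
  exists y, x; rewrite eq_sym setUC; split=> //; case/orP: (cover y yA) => // yE.
  by rewrite (sub A E x y) ?eqxx in AE.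
have TA : T \in A by rewrite AEq !inE eqxx.
have LA : L \in A by rewrite AEq !inE eqxx orbT.
have nTE : T \notin E by apply: contraNN AE => TE; apply/eqP; apply: sub AEq TL TE LE.
have nLC : L \notin C by apply: contraNN AC => LC; apply/eqP; apply: sub AEq TL TC LC.
have [R [CEq TR RC]] := other C T C2 TC; have [B [EEq LB BE]] := other E L E2 LE.
have RL : R != L by apply: contraNneq nLC => <-.
have BT : B != T by apply: contraNneq nTE => <-.
have nRA : R \notin A by rewrite AEq !inE negb_or eq_sym TR RL.
have nBA : B \notin A by rewrite AEq !inE negb_or [B == L]eq_sym LB BT.
have RD : R \in D by have := deg R; rewrite (negPf nRA) RC; case: (R \in D).
have BD : B \in D by have := deg B; rewrite (negPf nBA) BE addn1; case: (B \in D).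
have BR : B != R.
  apply/eqP=> E'; have := deg R; rewrite -{4}E' (negPf nRA) RC BE.
  by case: (R \in D).
exists T, L, B, R; split=> //; last 2 first.
- by rewrite EEq setUC.
- by apply/esym; apply: (sub _ D B R) => //.
by rewrite /= !inE !negb_or TL [T == B]eq_sym BT TR LB [L == R]eq_sym RL BR.
Qed.

End Weights.

(** * Necessity: at most one cycle in each component *)

Section AtMostOneCycle.
Variables (K : fieldType) (m n : nat) (M : {set minor_index m n}).
Hypothesis adjM : forall q, q \in M -> adjacent q.
Local Notation cell := 'I_(m * n).
Variables (d : nat) (e : cell -> {set 'I_d}).
Hypothesis einj : injective e.
Hypothesis e2 : forall k, #|e k| = 2.
Hypothesis IE : forall f : {mpoly K[m * n]}, in_minor_ideal M f <-> edge_subst e f = 0.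
Let chess : chessboard M := toric_chessboard adjM IE.
Let no4 : no_cycle_of_length (Gamma M) 4 := toric_no_4cycle adjM IE.
Let shape := block_shape adjM einj e2 IE.

(** The minors around the vertex v of G, two of them being adjacent when they
    share an edge of G at v. *)
Definition Gamma_at (v : 'I_d) : rel (minor_index m n) := fun p q =>
  Gamma M p q && [exists c, [&& in_block p c, in_block q c & v \in e c]].

Lemma common_vertex_side q c c' v : q \in M -> in_block q c -> in_block q c' ->
  v \in e c -> v \in e c' -> crow c = crow c' \/ ccol c = ccol c'.
Proof.
move=> qM /(in_blockP (adjM qM)) bc /(in_blockP (adjM qM)) bc' vc vc'.
have [T [L [B [R [U E1 E2 E3 E4]]]]] := shape qM.
move: U; rewrite /= !inE !negb_or => /and4P[/and3P[TL TB TR] /andP[LB LR] BR _].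
have Aq := adjM qM.
case: bc bc' vc vc' => -> [] ->; rewrite !cornerE //; try by [left | right].
all: rewrite ?E1 ?E2 ?E3 ?E4 !inE => /orP[] /eqP -> /orP[].
all: by rewrite ?[B == T]eq_sym ?[L == T]eq_sym ?[R == T]eq_sym ?[B == L]eq_sym
  ?[R == L]eq_sym ?[R == B]eq_sym ?(negPf TB) ?(negPf TL) ?(negPf TR) ?(negPf LB)
  ?(negPf LR) ?(negPf BR).
Qed.

Lemma Gamma_at_sym v : ssrbool.symmetric (Gamma_at v).
Proof.
move=> p q; rewrite /Gamma_at Gamma_sym; congr (_ && _).
by apply: eq_existsb => c; rewrite andbCA.
Qed.

(** Two cells of a minor with a common vertex are not opposite, so a walk among
    the minors around a vertex turns at every step. *)
Lemma Gamma_at_acyclic v s : ~~ graph_cycle (Gamma_at v) s.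
Proof.
apply/negP=> cyc; have [sz _] := andP cyc.
have [x xs] : exists x, x \in s by case: (s) sz => // x l; exists x; rewrite inE eqxx.
pose S x y := x \in s /\ y = next s x.
have SG a b : S a b -> Gamma M a b.
  by move=> [as_ ->]; have [_ /andP[]] := graph_cycle_next cyc as_.
apply: (@no_endless_staircase m n M adjM chess no4 S SG _ x (next s x)) => //.
move=> {x xs} x _ [xs ->].
have [ys rxy xz] := graph_cycle_next cyc xs; have [zs ryz _] := graph_cycle_next cyc ys.
exists (next s (next s x)) => //.
move: ys zs rxy ryz xz; set y := next s x; set z := next s y => ys zs rxy ryz xz.
have [gxy /existsP[c /and3P[xc yc vc]]] := andP rxy.
have [gyz /existsP[c' /and3P[yc' zc' vc']]] := andP ryz.
apply/negPn/negP=> nturn.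
have [Er Ec] := straight_line adjM chess gxy gyz xz nturn.
have [_ yM _ _ _] := Gamma_bounds adjM gxy.
have [d1 d2] := Gamma_diag adjM chess gxy.
have [c1 c2] := Gamma_corner_max adjM chess gxy xc yc.
have [c3 c4] := Gamma_corner_max adjM chess gyz yc' zc'.
have := common_vertex_side yM yc yc' vc vc'.
by rewrite c1 c2 c3 c4; clear -Er Ec d1 d2; lia.
Qed.

Lemma edge_ends c u : u \in e c -> exists w, [/\ u != w, e c = [set u; w] &
  forall (V : nmodType) (f : 'I_d -> V), \sum_(v in e c) f v = f u + f w].
Proof.
move=> uc; have /eqP/cards2P[a [b [ab E]]] := e2 c.
have H x y (V : nmodType) (f : 'I_d -> V) : x != y ->
    \sum_(v in [set x; y]) f v = f x + f y.
  by move=> xy; rewrite big_setU1 ?inE //= big_set1.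
move: uc; rewrite E !inE => /orP[] /eqP ->; [exists b | exists a]; split=> //.
- by move=> V f; apply: H.
- by rewrite eq_sym.
- by rewrite setUC.
- by move=> V f; rewrite setUC; apply: H; rewrite eq_sym.
Qed.

Definition jump (q q' x y : minor_index m n) : int :=
  ((x == q) && (y == q'))%:Z - ((x == q') && (y == q))%:Z.

(** A weight that on every block x is a sum over endpoints of a function [p x],
    these local functions fitting together except across one edge of Gamma. Each
    vertex v only asks for a potential on the forest [Gamma_at v]; opposite jumps
    at the two ends of the cell between q and q' keep the weight consistent. *)
Lemma local_potential q q' : Gamma M q q' ->
  exists (y : cell -> int) (p : minor_index m n -> 'I_d -> int),
  [/\ forall x c, x \in M -> in_block x c -> y c = \sum_(v in e c) p x v,
      exists c u, [/\ in_block q c, in_block q' c, u \in e c & p q' u = p q u + 1] &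
      forall x z c v, Gamma M x z -> [set x; z] != [set q; q'] ->
        in_block x c -> in_block z c -> v \in e c -> p z v = p x v].
Proof.
move=> gqq'; have [c0 qc0 q'c0] := Gamma_corner adjM chess gqq'.
have [u uc0] : exists u, u \in e c0 by apply/set0Pn; rewrite -cards_eq0 e2.
have [w [uw ec0 _]] := edge_ends uc0.
have qq' : q != q' by case/and5P: gqq'.
pose k v : int := (v == u)%:Z - (v == w)%:Z.
have /fin_all_exists[N NP] v : exists N : minor_index m n -> int,
    forall x z, Gamma_at v x z -> N z = N x + k v * jump q q' x z.
  apply: acyclic_potential; [exact: Gamma_at_sym| |exact: Gamma_at_acyclic|].
    by move=> x; rewrite /Gamma_at Gamma_irr.
  by move=> x z; rewrite /jump -mulrN opprB [(x == q) && _]andbC [(x == q') && _]andbC.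
have k0 : \sum_(v in e c0) k v = 0.
  by rewrite ec0 big_setU1 ?inE //= big_set1 /k !eqxx (negPf uw) eq_sym (negPf uw).
pose p x v := N v x.
have pP x z c v : Gamma M x z -> in_block x c -> in_block z c -> v \in e c ->
    p z v = p x v + k v * jump q q' x z.
  move=> g xc zc vc; apply: NP; rewrite /Gamma_at g; apply/existsP; exists c.
  by rewrite xc zc.
have jump0 x z : [set x; z] != [set q; q'] -> jump q q' x z = 0.
  move=> ne; rewrite /jump; case: (boolP (_ && _)) => [/andP[/eqP E /eqP E']|_].
    by rewrite E E' eqxx in ne.
  case: (boolP (_ && _)) => [/andP[/eqP E /eqP E']|_ //].
  by rewrite E E' setUC eqxx in ne.
pose y c := if [pick x in M | in_block x c] is Some x then \sum_(v in e c) p x v else 0.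
exists y, p; split.
- move=> x c xM xc; rewrite /y; case: pickP => [z /andP[zM zc]|/(_ x)]; last first.
    by rewrite xM xc.
  have [->//|xz] := eqVneq x z.
  have g : Gamma M z x by apply: Gamma_share zc xc; rewrite // eq_sym.
  apply/esym; rewrite (eq_bigr (fun v => p z v + k v * jump q q' z x)); last first.
    by move=> v vc; apply: pP g zc xc vc.
  rewrite big_split /= -mulr_suml.
  have [E|/jump0 ->] := eqVneq [set z; x] [set q; q']; last by rewrite mulr0 addr0.
  suff -> : c = c0 by rewrite k0 mul0r addr0.
  case/eq_set2: E => -[Ez Ex]; subst z x.
    exact: (Gamma_corner_uniq adjM chess gqq').
  exact: (Gamma_corner_uniq adjM chess gqq').
- exists c0, u; split=> //; rewrite (pP _ _ _ _ gqq' qc0 q'c0 uc0) /k /jump.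
  by rewrite !eqxx (negPf uw) (negPf qq') mul1r.
- by move=> x z c v g /jump0 j xc zc vc; rewrite (pP _ _ _ _ g xc zc vc) j mulr0 addr0.
Qed.

(** The difference of two functions on the vertices that induce the same weight
    on a 4-cycle changes sign along each of its edges. *)
Definition alternating (D : minor_index m n -> 'I_d -> rat) : Prop :=
  forall x c, x \in M -> in_block x c -> \sum_(v in e c) D x v = 0.

Definition glued (r : rel (minor_index m n)) (D : minor_index m n -> 'I_d -> rat) : Prop :=
  forall x z c v, r x z -> in_block x c -> in_block z c -> v \in e c -> D z v = D x v.

(** [D] is the difference between a function on the vertices of G and the local
    functions of [local_potential], all of which induce the same weight. *)
Lemma edge_defect q q' : Gamma M q q' ->
  exists D, [/\ alternating D, glued (remove_edge (Gamma M) [set q; q']) D &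
    exists c u, [/\ in_block q c, in_block q' c, u \in e c & D q' u = D q u - 1]].
Proof.
move=> g; have [y [p [yE [c [u [qc q'c uc pu]]] pglue]]] := local_potential g.
have ybal : balanced M y.
  move=> x xM; have [T [L [B [R [U E1 E2 E3 E4]]]]] := shape xM.
  have b k : k \in [:: nw x; ne x; sw x; se x] -> in_block x k.
    by move=> H; apply/(in_blockP (adjM xM)); move: H; rewrite !inE => /or4P[] /eqP;
      [constructor 1|constructor 2|constructor 3|constructor 4].
  have sum2 (a1 a2 : 'I_d) : a1 != a2 -> \sum_(v in [set a1; a2]) p x v = p x a1 + p x a2.
    by move=> a12; rewrite big_setU1 ?inE //= big_set1.
  rewrite !(yE x) ?b ?inE ?eqxx ?orbT // E1 E2 E3 E4.
  move: U; rewrite /= !inE !negb_or => /and4P[/and3P[TL TB TR] /andP[LB LR] BR _].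
  by rewrite !sum2 // 1?eq_sym //; ring.
have [a aE] := balanced_vertex_potential IE ybal.
exists (fun x v => a v - (p x v)%:~R); split.
- move=> x k xM xk; rewrite sumrB -aE (yE x) // rmorph_sum /=.
  exact: subrr.
- by move=> x z k v /andP[gxz ne] xk zk vk; rewrite (pglue x z k v).
- by exists c, u; split=> //; rewrite pu intrD opprD addrA.
Qed.

Definition block_vertex x v := exists2 c, in_block x c & v \in e c.

(** Around a 4-cycle all alternating functions change sign together. *)
Lemma alternating_block x v v' : x \in M -> block_vertex x v -> block_vertex x v' ->
  exists b : bool, forall D, alternating D -> D x v' = (-1) ^+ b * D x v.
Proof.
move=> xM; have [T [L [B [R [U E1 E2 E3 E4]]]]] := shape xM.
move: U; rewrite /= !inE !negb_or => /and4P[/and3P[TL TB TR] /andP[LB LR] BR _].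
have all4 z : block_vertex x z -> exists b : bool,
    forall D, alternating D -> D x z = (-1) ^+ b * D x T.
  have pair D c (a1 a2 : 'I_d) : alternating D -> in_block x c -> a1 != a2 ->
      e c = [set a1; a2] -> D x a2 = - D x a1.
    move=> Dalt xc a12 ec; have := Dalt x c xM xc.
    by rewrite ec big_setU1 ?inE //= big_set1 addrC => /eqP; rewrite addr_eq0 => /eqP.
  have [b1 b2 b3] : [/\ in_block x (nw x), in_block x (ne x) & in_block x (sw x)].
    by split; apply/(in_blockP (adjM xM)); [constructor 1|constructor 2|constructor 3].
  have zT : exists b : bool, forall D, alternating D -> D x T = (-1) ^+ b * D x T.
    by exists false => D _; rewrite expr0 mul1r.
  have zL : exists b : bool, forall D, alternating D -> D x L = (-1) ^+ b * D x T.
    by exists true => D Da; rewrite expr1 mulN1r; apply: pair Da b1 TL E1.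
  have zR : exists b : bool, forall D, alternating D -> D x R = (-1) ^+ b * D x T.
    by exists true => D Da; rewrite expr1 mulN1r; apply: pair Da b2 TR E2.
  have zB : exists b : bool, forall D, alternating D -> D x B = (-1) ^+ b * D x T.
    exists false => D Da; rewrite expr0 mul1r -[RHS]opprK -(pair D _ _ _ Da b1 TL E1).
    by apply: (pair D _ _ _ Da b3); rewrite // E3 setUC.
  move=> [c /(in_blockP (adjM xM)) xc]; case: xc => ->; rewrite ?E1 ?E2 ?E3 ?E4 !inE;
    by case/orP=> /eqP ->.
move=> /all4[b bP] /all4[b' b'P]; exists (b' (+) b) => D Da.
by rewrite (b'P D Da) (bP D Da); case: (b); case: (b') => /=; ring.
Qed.

(** The signs cancel in a product of two alternating functions, so that it is
    constant along the connected parts of Gamma where both are glued. *)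
Lemma transport r D1 D2 x z v w : subrel r (Gamma M) ->
  alternating D1 -> alternating D2 -> glued r D1 -> glued r D2 ->
  x \in M -> connect r x z -> block_vertex x v -> block_vertex z w ->
  D1 x v * D2 x v = D1 z w * D2 z w.
Proof.
move=> rG a1 a2 g1 g2 + /connectP[p + ->]; elim: p x v => [|t p IHp] x v xM /=.
  move=> _ xv zw; have [b bP] := alternating_block xM xv zw.
  by rewrite (bP _ a1) (bP _ a2) mulrACA -expr2 sqrr_sign mul1r.
move=> /andP[rxt pt] xv zw.
have [_ tM _ _ _] := Gamma_bounds adjM (rG _ _ rxt).
have [c xc tc] := Gamma_corner adjM chess (rG _ _ rxt).
have [u uc] : exists u, u \in e c by apply/set0Pn; rewrite -cards_eq0 e2.
have xu : block_vertex x u by exists c.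
have tu : block_vertex t u by exists c.
rewrite -(IHp t u tM pt tu zw) (g1 _ _ _ _ rxt xc tc uc) (g2 _ _ _ _ rxt xc tc uc).
have [b bP] := alternating_block xM xu xv.
by rewrite (bP _ a1) (bP _ a2) mulrACA -expr2 sqrr_sign mul1r.
Qed.

Lemma transport_neq0 r D x z v w : subrel r (Gamma M) ->
  alternating D -> glued r D -> x \in M -> connect r x z ->
  block_vertex x v -> block_vertex z w -> D x v != 0 -> D z w != 0.
Proof.
move=> rG a g xM con xv zw; have := transport rG a a g g xM con xv zw.
move=> E; apply: contraNneq => E0; move: E; rewrite E0 mulr0 -expr2 => /eqP.
by rewrite sqrf_eq0.
Qed.

(** The rest of the cycle transports the square of the defect from one end of
    the edge to the other; as the defect drops by 1 there, it goes from 1/2 to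
    -1/2, and it is nonzero wherever one can get without that edge. *)
Lemma edge_defect_cycle s q : graph_cycle (Gamma M) s -> q \in s ->
  let r := remove_edge (Gamma M) [set q; next s q] in
  exists D, [/\ alternating D, glued r D,
    forall x v, connect r q x -> block_vertex x v -> D x v != 0 &
    exists c u, [/\ in_block q c, in_block (next s q) c, u \in e c &
                    D (next s q) u = - D q u]].
Proof.
move=> cyc qs r; have [q's g _] := graph_cycle_next cyc qs.
have [D [Da Dg [c [u [qc q'c uc Du]]]]] := edge_defect g.
have [qM _ _ _ _] := Gamma_bounds adjM g.
have rG : subrel r (Gamma M) by move=> a b /andP[].
have con : connect r q (next s q) := graph_cycle_connect (@Gamma_sym m n M) cyc qs qs q's.
have qu : block_vertex q u by exists c.
have q'u : block_vertex (next s q) u by exists c.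
have E := transport rG Da Da Dg Dg qM con qu q'u.
have Dhalf : D q u = 2^-1 by rewrite Du in E; lra.
exists D; split=> //.
- move=> x v qx xv; apply: transport_neq0 rG Da Dg qM qx qu xv _.
  by rewrite Dhalf.
- by exists c, u; split=> //; rewrite Du Dhalf; lra.
Qed.

(** Let E be an edge of the first cycle that is not on the second one, and F an
    edge of the second cycle.  The product of their defects is a nonzero constant
    along the second cycle without F, but changes sign across F. *)
Lemma toric_at_most_one_cycle : components_at_most_one_cycle (Gamma M) M.
Proof.
suff main x s1 s2 (E : {set minor_index m n}) :
    graph_cycle (Gamma M) s1 -> {subset s1 <= connect (Gamma M) x} ->
    graph_cycle (Gamma M) s2 -> {subset s2 <= connect (Gamma M) x} ->
    E \in cycle_edges s1 -> E \in cycle_edges s2.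
  move=> x _ s1 s2 c1 x1 c2 x2; apply/setP=> E; apply/idP/idP.
    exact: main c1 x1 c2 x2.
  exact: main c2 x2 c1 x1.
move=> c1 x1 c2 x2 E1; apply/negPn/negP=> E2.
have /cycle_edgeP[q1 q1s EE] := E1; subst E.
have [q1's g1 _] := graph_cycle_next c1 q1s.
have [sz2 _] := andP c2.
have [q2 q2s] : exists q2, q2 \in s2.
  by case: (s2) sz2 => // z l; exists z; rewrite inE eqxx.
have [q2's g2 _] := graph_cycle_next c2 q2s.
have [q2M q2'M _ _ _] := Gamma_bounds adjM g2.
have [D1 [a1 gl1 nz1 _]] := edge_defect_cycle c1 q1s.
have [D2 [a2 gl2 nz2 [c [w [q2c q2'c wc D2w]]]]] := edge_defect_cycle c2 q2s.
set F1 := [set q1; _] in E2 gl1 nz1.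
set F2 := [set q2; _] in gl2 nz2.
have GC := @Gamma_sym m n M.
have con1 : connect (remove_edge (Gamma M) F1) q1 q2.
  have: connect (Gamma M) q1 q2.
    apply: connect_trans (x2 _ q2s); rewrite (sym_connect_sym GC); exact: x1.
  apply: connect_sub => a b gab; have [/eq_set2 Eab|nab] := eqVneq [set a; b] F1.
    by case: Eab => -[-> ->]; apply: (graph_cycle_connect GC c1 q1s).
  by apply: connect1; rewrite /remove_edge gab.
pose r := remove_edge (remove_edge (Gamma M) F1) F2.
have con2 : connect r q2 (next s2 q2).
  apply: (graph_cycle_connect (remove_edge_sym F1 GC)) => //.
  exact: graph_cycle_remove.
have rG : subrel r (Gamma M) by move=> a b /andP[/andP[]].
have b2 : block_vertex q2 w by exists c.
have b2' : block_vertex (next s2 q2) w by exists c.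
have glr1 : glued r D1 by move=> a b k v /andP[rab _]; apply: gl1.
have glr2 : glued r D2.
  by move=> a b k v /andP[/andP[gab _] nab]; apply: gl2; rewrite /remove_edge gab.
have := transport rG a1 a2 glr1 glr2 q2M con2 b2 b2'.
have F12 : F2 != F1.
  by apply: contraNneq E2 => <-; apply/cycle_edgeP; exists q2.
rewrite D2w (gl1 q2 (next s2 q2) c w) // ?/remove_edge ?g2 //.
have := nz1 q2 w con1 b2; have := nz2 q2 w (connect0 _ _) b2.
move=> nz2' nz1'; rewrite mulrN => /eqP; rewrite -addr_eq0 -mulr2n mulrn_eq0 /=.
by rewrite mulf_eq0 (negPf nz1') (negPf nz2').
Qed.

End AtMostOneCycle.

(** * Sufficiency: normal forms of monomials *)

Section NormalForms.
Variables (K : fieldType) (m n : nat) (M : {set minor_index m n}).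
Hypothesis adjM : forall q, q \in M -> adjacent q.
Hypothesis chess : chessboard M.
Hypothesis no4 : no_cycle_of_length (Gamma M) 4.
Local Notation cell := 'I_(m * n).
Variables (d : nat) (e : cell -> {set 'I_d}).
Hypothesis block_cycle : forall q v, q \in M ->
  (vdeg e U_(nw q) v + vdeg e U_(se q) v = vdeg e U_(ne q) v + vdeg e U_(sw q) v)%N.
Hypothesis vertex_potential : forall y : cell -> rat, balanced M y ->
  exists a : 'I_d -> rat, forall k, y k = \sum_(v in e k) a v.

(** The leading monomial of a minor is its diagonal in even rows and its
    antidiagonal in odd rows; the parity of the sum below says on which of
    the two a corner lies.  A cell shared by two minors is then leading in
    exactly one of them, because their columns have different parities. *)
Definition leading (q : minor_index m n) (c : cell) : bool :=
  ~~ odd (crow c + ccol c + mcol q).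

Definition normal (u : 'X_{1..m * n}) : bool :=
  [forall q in M, exists c, [&& in_block q c, leading q c & u c == 0%N]].

Definition lead1 q := if odd (mrow q) then ne q else nw q : cell.
Definition lead2 q := if odd (mrow q) then sw q else se q : cell.
Definition trail1 q := if odd (mrow q) then nw q else ne q : cell.
Definition trail2 q := if odd (mrow q) then se q else sw q : cell.

Lemma minor_leading q : adjacent q ->
  minor2 K q = (-1) ^+ odd (mrow q) *
    ('X_(lead1 q) * 'X_(lead2 q) - 'X_(trail1 q) * 'X_(trail2 q)).
Proof.
move=> Aq; rewrite minor2E /lead1 /lead2 /trail1 /trail2.
by case: (odd _); rewrite ?expr1 ?expr0; ring.
Qed.

(** A weight that drops by one whenever a leading monomial is replaced. *)
Definition height (c : cell) : nat := odd (crow c) * ccol c.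
Definition total_height (u : 'X_{1..m * n}) : nat := (\sum_k u k * height k)%N.

Lemma total_heightD u w : total_height (u + w) = (total_height u + total_height w)%N.
Proof.
rewrite /total_height -big_split; apply: eq_bigr => k _ /=.
by rewrite mnmDE mulnDl.
Qed.

Lemma total_heightU k : total_height U_(k) = height k.
Proof.
rewrite /total_height (bigD1 k) //= mnm1E eqxx mul1n big1 ?addn0 // => j /negPf.
by rewrite mnm1E eq_sym => ->.
Qed.

Lemma height_lead q : adjacent q ->
  (height (lead1 q) + height (lead2 q) = (height (trail1 q) + height (trail2 q)).+1)%N.
Proof.
move=> Aq; rewrite /height /lead1 /lead2 /trail1 /trail2.
by case: (boolP (odd (mrow q))) => o; rewrite !cornerE //= ?o ?(negPf o); lia.
Qed.

Lemma normal_form u : exists2 u', normal u' &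
  in_minor_ideal M ('X_[u] - 'X_[u'] : {mpoly K[m * n]}).
Proof.
have [h] := ubnP (total_height u); elim: h u => // h IHh u /ltnSE lt_uh.
have [nu|] := boolP (normal u).
  by exists u; rewrite // subrr; apply: in_generated_ideal0.
case/forall_inPn=> q qM /existsPn nq; have Aq := adjM qM.
have pos c : in_block q c -> leading q c -> (0 < u c)%N.
  by move=> qc lc; have := nq c; rewrite qc lc lt0n.
have [b1 l1] : in_block q (lead1 q) /\ leading q (lead1 q).
  rewrite /leading /lead1; case: (boolP (odd (mrow q))) => o; rewrite !cornerE //;
    by split; [apply/(in_blockP Aq); first [by constructor 1 | by constructor 2]
              | clear -o; lia].
have [b2 l2] : in_block q (lead2 q) /\ leading q (lead2 q).
  rewrite /leading /lead2; case: (boolP (odd (mrow q))) => o; rewrite !cornerE //;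
    by split; [apply/(in_blockP Aq); first [by constructor 3 | by constructor 4]
              | clear -o; lia].
have [p1 p2] := (pos _ b1 l1, pos _ b2 l2).
have l12 : lead1 q != lead2 q.
  by rewrite cell_eqE /lead1 /lead2; case: ifP => _; rewrite !cornerE //; lia.
have /submK uE : (U_(lead1 q) + U_(lead2 q) <= u)%MM.
  apply/mnm_lepP=> k; rewrite mnmDE !mnm1E.
  by case: (eqVneq (lead1 q) k) l12 => [<-|_ _];
    case: (eqVneq (lead2 q) _) => // E; rewrite -?E ?eqxx.
set v := (u - _)%MM in uE.
have [|u' nu' u'I] := IHh (v + (U_(trail1 q) + U_(trail2 q)))%MM.
  move: lt_uh; rewrite -uE !total_heightD !total_heightU; have := height_lead Aq.
  lia.
exists u' => //; have qI := in_generated_ideal_gen (@minor2 K m n) qM.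
have := in_generated_idealD (in_generated_idealM ((-1) ^+ odd (mrow q) * 'X_[v]) qI) u'I.
suff -> : (-1) ^+ odd (mrow q) * 'X_[v] * minor2 K q +
    ('X_[v + (U_(trail1 q) + U_(trail2 q))] - 'X_[u']) = 'X_[u] - 'X_[u'] by [].
rewrite minor_leading // mulrACA mulrA -exprD -[in RHS]uE !mpolyXD.
by case: (odd _) => /=; ring.
Qed.

Lemma block_sum (q : minor_index m n) (f : cell -> rat) : adjacent q ->
  \sum_(k | in_block q k) f k = f (nw q) + f (ne q) + f (sw q) + f (se q).
Proof.
move=> Aq.
rewrite (bigD1 (nw q)) /=; last by apply/(in_blockP Aq); constructor 1.
rewrite (bigD1 (ne q)) /=; last first.
  rewrite cell_eqE !cornerE //; apply/andP; split; last by lia.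
  by apply/(in_blockP Aq); constructor 2.
rewrite (bigD1 (sw q)) /=; last first.
  rewrite !cell_eqE !cornerE //; apply/andP; split; last by lia.
  by apply/andP; split; [apply/(in_blockP Aq); constructor 3 | lia].
rewrite (big_pred1 (se q)) ?addrA // => k; apply/idP/eqP=> [|->].
  move=> /andP[/andP[/andP[/(in_blockP Aq)[] -> /= h1 h2 h3]]] //;
    by move: h1 h2 h3; rewrite !eqxx.
rewrite !cell_eqE !cornerE //; apply/andP; split; last by lia.
apply/andP; split; last by lia.
by apply/andP; split; [apply/(in_blockP Aq); constructor 4 | lia].
Qed.

Definition relation_vector (q : minor_index m n) (c : cell) : rat :=
  if (q \in M) && in_block q c then (if leading q c then 1 else -1) else 0.

(** Dually to the hypothesis that balanced weights come from the vertices. *)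
Lemma fibre_relation_span u w : vdeg e u = vdeg e w ->
  exists N : minor_index m n -> rat,
    forall k, (u k)%:R - (w k)%:R = \sum_q N q * relation_vector q k.
Proof.
move=> uw; apply: orthogonal_span => y yM.
have ybal : balanced M y.
  move=> q qM; have Aq := adjM qM; have := yM q.
  under eq_bigr => k _ do rewrite /relation_vector qM /= (fun_if (fun x => x * y k)) mul0r.
  rewrite -big_mkcond block_sum // /leading !cornerE // !(oddD, oddS) /=.
  by case: (odd (mrow q)); case: (odd (mcol q)) => /=; lra.
have [a aE] := vertex_potential ybal.
transitivity (\sum_v a v * ((vdeg e u v)%:R - (vdeg e w v)%:R)); last first.
  by rewrite uw big1 // => v _; rewrite subrr mulr0.
transitivity (\sum_v \sum_k a v * ((v \in e k)%:R * ((u k)%:R - (w k)%:R))).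
  rewrite exchange_big; apply: eq_bigr => k _ /=.
  rewrite aE big_mkcond mulr_sumr; apply: eq_bigr => v _.
  by case: ifP => _; rewrite ?mul1r ?mul0r ?mulr0 // mulrC.
apply: eq_bigr => v _; rewrite -mulr_sumr; congr (_ * _).
rewrite !mnmE !natr_sum -sumrB; apply: eq_bigr => k _.
by rewrite !natrM -mulrBl mulrC.
Qed.

(** If some coefficient were positive, consider a minor where it is largest. As
    [u] is not divisible by its leading monomial, the coefficient is cancelled at
    one of the two leading cells by the coefficient of another minor, which is
    therefore largest as well, and for which this cell is not leading.  So the
    next such step leaves the second minor through a cell next to this one, with
    a turn, and there is an endless staircase. *)
Lemma normal_coef_le0 (u w : 'X_{1..m * n}) (N : minor_index m n -> rat) :
  normal u -> (forall k, (u k)%:R - (w k)%:R = \sum_q N q * relation_vector q k) ->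
  forall q, q \in M -> N q <= 0.
Proof.
move=> nu uwE q0 q0M; rewrite leNgt; apply/negP=> q0pos.
pose top := [arg max_(q > q0 in M) N q]%O.
have [topM topP] : top \in M /\ forall q, q \in M -> N q <= N top.
  by rewrite /top; case: Order.TotalTheory.arg_maxP.
have top_pos : 0 < N top by apply: lt_le_trans (topP _ q0M).
pose S x y := [/\ x \in M, N x = N top, Gamma M x y, N y = N top &
  exists c, [/\ in_block x c, in_block y c & leading x c]].
have next x : x \in M -> N x = N top -> exists y, S x y.
  move=> xM xtop; move/forall_inP: nu => /(_ x xM)/existsP[c /and3P[xc lc /eqP uc]].
  have := uwE c; rewrite uc sub0r (bigD1 x) //= {1}/relation_vector xM xc lc mulr1.
  have wc : - (w c)%:R <= 0 :> rat by rewrite oppr_le0 ler0n.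
  case: (pickP (fun y => [&& y \in M, y != x & in_block y c])) => [y|none]; last first.
    rewrite big1 ?addr0 => [E|y yx]; first by move: wc; rewrite E xtop leNgt top_pos.
    rewrite /relation_vector; move: (none y); rewrite yx /=.
    by case: (y \in M) => /= [->|_]; rewrite mulr0.
  move=> /and3P[yM yx yc].
  have g : Gamma M x y by apply: Gamma_share xc yc; rewrite // eq_sym.
  have ly : ~~ leading y c.
    have [_ k] := Gamma_diag adjM chess g.
    move: lc; rewrite /leading !oddD.
    by case: k => -> /=; case: (odd _); case: (odd _); case: (odd _).
  rewrite (bigD1 y) //= {1}/relation_vector yM yc (negPf ly) big1 ?addr0; last first.
    move=> z /andP[zx zy]; rewrite /relation_vector; case: ifP; rewrite ?mulr0 //.
    move=> /andP[zM zc].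
    by rewrite (block_pair_uniq adjM chess xM yM zM _ _ xc yc zc) ?eqxx // eq_sym in zy.
  rewrite mulrN1 => E; exists y; split=> //; last by exists c.
  apply/eqP; rewrite eq_le topP //= -xtop -subr_le0 -E; exact: wc.
have [y0 Stop] := next top topM erefl.
apply: (@no_endless_staircase m n M adjM chess no4 S _ _ top y0) => //.
  by move=> x y [].
move=> x y [xM xtop gxy ytop [c [xc yc lc]]].
have [_ yM _ _ _] := Gamma_bounds adjM gxy.
have [z Syz] := next y yM ytop; exists z => //.
have [_ _ gyz _ [c' [yc' zc' lc']]] := Syz.
have [d1 d2] := Gamma_diag adjM chess gxy; have [d3 d4] := Gamma_diag adjM chess gyz.
have [r1 k1] := Gamma_corner_max adjM chess gxy xc yc.
have [r2 k2] := Gamma_corner_max adjM chess gyz yc' zc'.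
have par : odd (crow c + ccol c) != odd (crow c' + ccol c').
  move: lc lc'; rewrite /leading ![odd (_ + mcol _)]oddD.
  by case: d2 => -> /=; case: (odd (mcol _)); case: (odd _); case: (odd _).
rewrite /turn; have -> : (mrow x == mrow z) = (crow c == crow c').
  by rewrite r1 r2; clear -d1 d3; lia.
have -> : (mcol x == mcol z) = (ccol c == ccol c').
  by rewrite k1 k2; clear -d2 d4; lia.
case: (eqVneq (crow c) (crow c')) => [Er|nr]; case: (eqVneq (ccol c) (ccol c')) => [Ec|nc] //=.
  by rewrite Er Ec eqxx in par.
move: par; rewrite /in_block in yc yc'; clear -yc yc' nr nc.
suff -> : odd (crow c + ccol c) = odd (crow c' + ccol c') by rewrite eqxx.
lia.
Qed.

Lemma normal_inj u w : normal u -> normal w -> vdeg e u = vdeg e w -> u = w.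
Proof.
move=> nu nw uw; have [N NE] := fibre_relation_span uw.
have le0 := normal_coef_le0 nu NE.
have ge0 : forall q, q \in M -> - N q <= 0.
  apply: (normal_coef_le0 (u := w) (w := u) (N := fun q => - N q)) => // k.
  by rewrite -opprB NE -sumrN; apply: eq_bigr => q _; rewrite mulNr.
apply/mnmP=> k; apply/eqP; rewrite -(eqr_nat rat) -subr_eq0 NE big1 // => q _.
rewrite /relation_vector; case: (boolP (q \in M)) => [qM|_]; last by rewrite mulr0.
suff ->: N q = 0 by rewrite mul0r.
by apply/eqP; rewrite eq_le le0 //= -oppr_le0 ge0.
Qed.

Lemma minor_idealE (f : {mpoly K[m * n]}) : in_minor_ideal M f <-> edge_subst e f = 0.
Proof.
have gen_ker q : q \in M -> edge_subst e (minor2 K q) = 0.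
  move=> qM; rewrite minor2E -!mpolyXD; apply/edge_subst_binomial.
  by apply/mnmP=> v; rewrite !vdegD !mnmDE block_cycle.
have sub (g : {mpoly K[m * n]}) : in_minor_ideal M g -> edge_subst e g = 0.
  pose phi : {rmorphism {mpoly K[m * n]} -> {mpoly K[d]}} :=
    comp_mpoly [tuple edge_monomial K (e k) | k < m * n].
  exact: (in_generated_ideal_morph (phi := phi)).
split; first exact: sub.
apply: ker_edge_subst_sub => u w uw.
have [u' nu' u'I] := normal_form u; have [w' nw' w'I] := normal_form w.
have uE : vdeg e u = vdeg e u' by apply/(edge_subst_binomial K); apply: sub.
have wE : vdeg e w = vdeg e w' by apply/(edge_subst_binomial K); apply: sub.
have E : u' = w' by apply: normal_inj; rewrite // -uE -wE.
by have := in_generated_idealB u'I w'I; rewrite E opprB addrA subrK.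
Qed.

End NormalForms.

(** * Sufficiency: gluing the 4-cycles with a twist *)

Section TwistedEdges.
Variables (m n : nat) (M : {set minor_index m n}).
Hypothesis adjM : forall q, q \in M -> adjacent q.
Hypothesis chess : chessboard M.
Hypothesis one : components_at_most_one_cycle (Gamma M) M.

Lemma graph_cycle_sub_connect (s : seq (minor_index m n)) x :
  graph_cycle (Gamma M) s -> x \in s -> {subset s <= connect (Gamma M) x}.
Proof.
move=> cyc xs z zs; have := graph_cycle_connect (@Gamma_sym m n M) cyc xs xs zs.
by apply: connect_sub => a b /andP[gab _]; apply: connect1.
Qed.

(** One edge is chosen on the cycle of every component that has a cycle; it is
    directed downwards to tell its ends apart. *)
Lemma twisted_edges : exists twisted : rel (minor_index m n),
  [/\ forall x y, twisted x y -> Gamma M x y /\ mrow y = (mrow x).+1,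
      forall x y x' y', twisted x y -> twisted x' y' -> connect (Gamma M) x x' ->
        x = x' /\ y = y' &
      forall s, ~~ graph_cycle
        (fun x y => [&& Gamma M x y, ~~ twisted x y & ~~ twisted y x]) s].
Proof.
have GC := @Gamma_sym m n M; have GCC := sym_connect_sym GC.
have /fin_all_exists[o oP] (r : minor_index m n) :
  exists o : option (minor_index m n * minor_index m n),
    (forall x y, o = Some (x, y) -> Gamma M x y /\ mrow y = (mrow x).+1) /\
    (forall s, graph_cycle (Gamma M) s -> {subset s <= connect (Gamma M) r} ->
       exists x y, o = Some (x, y) /\ [set x; y] \in cycle_edges s).
  have [[s0 [c0 r0]]|none] := classic (exists s,
      graph_cycle (Gamma M) s /\ {subset s <= connect (Gamma M) r}); last first.
    by exists None; split=> // s cs rs; case: none; exists s.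
  have [q qs] : exists q, q \in s0.
    by case: (s0) c0 => // z l _; exists z; rewrite inE eqxx.
  have [q's g _] := graph_cycle_next c0 qs.
  have [qM _ _ _ _] := Gamma_bounds adjM g.
  have cE s : graph_cycle (Gamma M) s -> {subset s <= connect (Gamma M) r} ->
      [set q; next s0 q] \in cycle_edges s.
    move=> cs rs; rewrite (one qM cs _ c0); first by apply/cycle_edgeP; exists q.
      move=> z /rs; apply: connect_trans; rewrite GCC; exact: r0.
    move=> z /r0; apply: connect_trans; rewrite GCC; exact: r0.
  have [[E|E] _] := Gamma_diag adjM chess g.
    exists (Some (q, next s0 q)); split=> [x y [<- <-] //|s cs rs].
    by exists q, (next s0 q); split=> //; apply: cE.
  exists (Some (next s0 q, q)); split=> [x y [<- <-]|s cs rs].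
    by rewrite GC.
  by exists (next s0 q), q; split=> //; rewrite setUC; apply: cE.
pose twisted x y := o (fingraph.root (Gamma M) x) == Some (x, y).
exists twisted; split.
- by move=> x y /eqP; apply: (proj1 (oP _)).
- move=> x y x' y' /eqP E /eqP E' con.
  by move: E; rewrite (fingraph.rootP GCC con) E' => -[-> ->].
move=> s; apply/negP=> cyc.
have cs : graph_cycle (Gamma M) s by apply: sub_graph_cycle cyc => a b /and3P[].
have [z zs] : exists z, z \in s.
  by case: (s) cyc => // z l _; exists z; rewrite inE eqxx.
have [|x [y [oE /cycle_edgeP[w ws Ew]]]] := proj2 (oP (fingraph.root (Gamma M) z)) s cs.
  move=> a /(graph_cycle_sub_connect cs zs); apply: connect_trans.
  by rewrite GCC; apply: connect_root.
have [_ /and3P[gw nt nt'] _] := graph_cycle_next cyc ws.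
have rE a : a \in s -> fingraph.root (Gamma M) a = fingraph.root (Gamma M) z.
  by move=> /(graph_cycle_sub_connect cs zs)/(fingraph.rootP GCC)->.
have w's : next s w \in s by rewrite mem_next.
case/eq_set2: Ew => -[Ex Ey]; subst x y.
  by case/negP: nt; rewrite /twisted rE // oE.
by case/negP: nt'; rewrite /twisted rE // oE.
Qed.

End TwistedEdges.

Section Graph.
Variables (m n : nat) (M : {set minor_index m n}).
Hypothesis adjM : forall q, q \in M -> adjacent q.
Hypothesis chess : chessboard M.
Local Notation cell := 'I_(m * n).
Variable twisted : rel (minor_index m n).
Hypothesis twistedG : forall x y, twisted x y -> Gamma M x y /\ mrow y = (mrow x).+1.
Hypothesis twisted_uniq : forall x y x' y', twisted x y -> twisted x' y' ->
  connect (Gamma M) x x' -> x = x' /\ y = y'.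
Hypothesis twisted_acyclic : forall s, ~~ graph_cycle
  (fun x y => [&& Gamma M x y, ~~ twisted x y & ~~ twisted y x]) s.

Let GC : ssrbool.symmetric (Gamma M) := @Gamma_sym m n M.
Let GCC : connect_sym (Gamma M) := sym_connect_sym GC.

(** A cell becomes an edge with two ends, [(c, false)] and [(c, true)].  The
    4-cycle of a minor attaches its horizontal sides to the ends [false] and
    its vertical sides to the ends [true], except at the cell of a twisted edge,
    where the lower minor exchanges the two. *)
Definition flip (q : minor_index m n) (c : cell) : bool :=
  [exists p, [&& twisted p q, in_block p c & in_block q c]].

Definition link : rel (cell * bool) := fun f g =>
  [exists q in M, [&& in_block q f.1, in_block q g.1 &
    ((crow f.1 == crow g.1) && (f.2 == flip q f.1) && (g.2 == flip q g.1)) ||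
    ((ccol f.1 == ccol g.1) && (f.2 == ~~ flip q f.1) && (g.2 == ~~ flip q g.1))]].

Lemma link_sym : ssrbool.symmetric link.
Proof.
move=> f g; apply: eq_existsb => q; congr (_ && _); rewrite andbCA; congr [&& _, _ & _].
by rewrite eq_sym [ccol _ == _]eq_sym -!andbA;
   congr (_ && _ || _ && _); apply: andbC.
Qed.

Definition vtx (f : cell * bool) : 'I_#|{: cell * bool}| := enum_rank (fingraph.root link f).

Definition ends (c : cell) : {set 'I_#|{: cell * bool}|} :=
  [set vtx (c, false); vtx (c, true)].

(** A function on the ends that is constant along the sides of all minors is a
    function on the vertices. *)
Lemma link_invariant (X : Type) (a : cell -> bool -> X) :
  (forall q c c', q \in M -> in_block q c -> in_block q c' -> crow c = crow c' ->
     a c (flip q c) = a c' (flip q c')) ->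
  (forall q c c', q \in M -> in_block q c -> in_block q c' -> ccol c = ccol c' ->
     a c (~~ flip q c) = a c' (~~ flip q c')) ->
  forall f g, connect link f g -> a f.1 f.2 = a g.1 g.2.
Proof.
move=> rowP colP f g /connectP[p + ->]; elim: p f => //= h p IHp f /andP[fh /IHp <-].
case/existsP: fh => q /and4P[qM qf qh].
case/orP=> /andP[/andP[/eqP E /eqP ->] /eqP ->]; first exact: rowP.
exact: colP.
Qed.

Lemma vtxP f g : reflect (connect link f g) (vtx f == vtx g).
Proof.
by rewrite (inj_eq enum_rank_inj);
  apply: (iffP eqP) => /(fingraph.rootP (sym_connect_sym link_sym)).
Qed.

Lemma flipP q c p : q \in M -> p \in M -> p != q -> in_block p c -> in_block q c ->
  flip q c = twisted p q.
Proof.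
move=> qM pM pq pc qc; apply/existsP/idP=> [[x /and3P[t xc _]]|t]; last first.
  by exists p; rewrite t pc qc.
have [g _] := twistedG t; have [xM _ xq _ _] := Gamma_bounds adjM g.
by rewrite (block_pair_uniq adjM chess qM pM xM _ _ qc pc xc) // eq_sym.
Qed.

Definition component (q0 : minor_index m n) (c : cell) : bool :=
  [exists q in M, in_block q c && connect (Gamma M) q0 q].

Lemma component_block q0 q c : q \in M -> in_block q c ->
  component q0 c = connect (Gamma M) q0 q.
Proof.
move=> qM qc; apply/existsP/idP=> [[x /and3P[xM xc con]]|con]; last first.
  by exists q; rewrite qM qc.
have [<-//|xq] := eqVneq x q.
by apply: connect_trans con (connect1 (Gamma_share adjM xM qM xq xc qc)).
Qed.

(** A colouring need only respect the sides of the minors of one component. *)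
Lemma no_loop_by (a : cell -> bool -> bool) q0 c : q0 \in M -> in_block q0 c ->
  (forall q c c', q \in M -> connect (Gamma M) q0 q -> in_block q c -> in_block q c' ->
     crow c = crow c' -> a c (flip q c) = a c' (flip q c')) ->
  (forall q c c', q \in M -> connect (Gamma M) q0 q -> in_block q c -> in_block q c' ->
     ccol c = ccol c' -> a c (~~ flip q c) = a c' (~~ flip q c')) ->
  a c false != a c true -> vtx (c, false) != vtx (c, true).
Proof.
move=> q0M q0c rowP colP nac; apply/negP=> /vtxP con.
have := @link_invariant bool (fun c' h => component q0 c' && a c' h) _ _ _ _ con.
rewrite /= (component_block _ q0M q0c) connect0 /= => H; case/eqP: nac; apply: H.
  move=> q k k' qM qk qk' E; rewrite !(component_block _ qM) //.
  by case: (boolP (connect _ _ _)) => // cq /=; apply: rowP.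
move=> q k k' qM qk qk' E; rewrite !(component_block _ qM) //.
by case: (boolP (connect _ _ _)) => // cq /=; apply: colP.
Qed.

Lemma flip_component p q c x k : twisted p q -> in_block p c -> in_block q c ->
  connect (Gamma M) p x -> flip x k = (x == q) && (k == c).
Proof.
move=> t pc qc px; apply/existsP/andP=> [[y /and3P[ty yk xk]]|[/eqP -> /eqP ->]]; last first.
  by exists p; rewrite t pc qc.
have [g' _] := twistedG ty.
have [Ep Eq] : p = y /\ q = x.
  apply: (twisted_uniq t ty); apply: connect_trans px _.
  by apply: connect1; rewrite GC.
subst y x; have [g _] := twistedG t.
by rewrite eqxx (Gamma_corner_uniq adjM chess g yk xk pc qc).
Qed.

(** The row and the column of the twisted cell are cut there into four arms.  For
    a diagonal edge one of its vertices carries the left and lower arms and the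
    other one the right and upper arms; for an antidiagonal edge these are the
    right and lower and the left and upper arms.  A colouring of the ends tells
    the two vertices apart. *)
Lemma no_loop_twisted p q c : twisted p q -> in_block p c -> in_block q c ->
  vtx (c, false) != vtx (c, true).
Proof.
move=> t pc qc; have [g Er] := twistedG t.
have [pM qM pq _ _] := Gamma_bounds adjM g.
have [Ec1 Ec2] := Gamma_corner_max adjM chess g pc qc.
have F x k : connect (Gamma M) p x -> flip x k = (x == q) && (k == c).
  exact: flip_component.
have third x : x \in M -> x != p -> x != q -> ~~ in_block x c.
  move=> xM xp xq; apply/negP=> xc; case/eqP: xq.
  by apply: (block_pair_uniq adjM chess pM xM qM _ _ pc xc qc); rewrite // eq_sym.
have [_ [Ec|Ec]] := Gamma_diag adjM chess g;
  [pose a (k : cell) (h : bool) :=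
     if h then ~~ ((ccol k == ccol c) && (crow c < crow k)%N)
     else (crow k == crow c) && (ccol c < ccol k)%N
  |pose a (k : cell) (h : bool) :=
     if h then (ccol k == ccol c) && (crow c < crow k)%N
     else (crow k == crow c) && (ccol c <= ccol k)%N];
  (apply: (no_loop_by (a := a) pM pc); last by rewrite /a; lia);
  move=> x k k' xM px xk xk' E; rewrite !F // /a;
  (have [Ex|xq] := eqVneq x q;
    [subst x; rewrite /= !cell_eqE; clear -Ec Er Ec1 Ec2 xk xk' E;
     move: xk xk'; rewrite /in_block;
     case: ifP => h1; case: ifP => h2; move: h1 h2; lia
    |have [Ex|xp] := eqVneq x p;
      [subst x => /=; clear -Ec Er Ec1 Ec2 xk xk' E; move: xk xk'; rewrite /in_block; lia
      |have := third x xM xp xq; rewrite /= /in_block; clear -xk xk' E;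
       move: xk xk'; rewrite /in_block; lia]]).
Qed.

(** In a component without a twist, the ends [false] and [true] never meet.
    Otherwise, away from the row (or the column) of the twisted cell, a twist
    does not affect the ends [false] of one row (or [true] of one column). *)
Lemma no_loop c : vtx (c, false) != vtx (c, true).
Proof.
case: (pickP (fun q => (q \in M) && in_block q c)) => [q0 /andP[q0M q0c]|none]; last first.
  apply/negP=> /vtxP con.
  have := @link_invariant bool (fun k h => (k == c) && h) _ _ _ _ con.
  rewrite /= !eqxx /= => H; suff: false = true by [].
  apply: H => q k k' qM qk qk' _; move: (none q); rewrite qM /=.
    case: eqP => [<-|_]; first by rewrite qk.
    by case: eqP => [<-|//]; rewrite qk'.
  case: eqP => [<-|_]; first by rewrite qk.
  by case: eqP => [<-|//]; rewrite qk'.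
case: (pickP (fun pq : minor_index m n * minor_index m n =>
    twisted pq.1 pq.2 && connect (Gamma M) q0 pq.1)) => [[p q] /= /andP[t q0p]|none]; last first.
  have F x k : connect (Gamma M) q0 x -> flip x k = false.
    move=> q0x; apply/existsP=> -[p /and3P[t _ _]]; move: (none (p, x)).
    rewrite /= t (connect_trans q0x) // connect1 // GC; exact: (proj1 (twistedG t)).
  by apply: (no_loop_by (a := fun _ h => h) q0M q0c) => // q k k' _ cq *; rewrite !F.
have [g _] := twistedG t.
have [k pk qk] := Gamma_corner adjM chess g.
have F x l : connect (Gamma M) q0 x -> flip x l = (x == q) && (l == k).
  by move=> q0x; apply: (flip_component _ t pk qk); apply: connect_trans q0x; rewrite GCC.
have [<-|ck] := eqVneq k c; first exact: no_loop_twisted t pk qk.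
have {ck} [nr|nc] : crow c != crow k \/ ccol c != ccol k.
  by move: ck; rewrite cell_eqE negb_and => /orP[]; rewrite eq_sym; [left|right].
- have fk x l : connect (Gamma M) q0 x -> flip x l && (crow l == crow c) = false.
    move=> q0x; rewrite F //; case: (eqVneq l k) => [->|]; rewrite ?andbF //.
    by rewrite [crow k == _]eq_sym (negPf nr) andbF.
  apply: (no_loop_by (a := fun l h => ~~ h && (crow l == crow c)) q0M q0c);
    last by rewrite /= eqxx.
    move=> x l l' xM q0x xl xl' E; have := fk x l q0x; have := fk x l' q0x.
    by rewrite E; case: (crow l' == _); case: (flip x l); case: (flip x l').
  by move=> x l l' xM q0x xl xl' E; rewrite !negbK !fk.
- have fk x l : connect (Gamma M) q0 x -> flip x l && (ccol l == ccol c) = false.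
    move=> q0x; rewrite F //; case: (eqVneq l k) => [->|]; rewrite ?andbF //.
    by rewrite [ccol k == _]eq_sym (negPf nc) andbF.
  apply: (no_loop_by (a := fun l h => h && (ccol l == ccol c)) q0M q0c);
    last by rewrite /= eqxx.
    by move=> x l l' xM q0x xl xl' E; rewrite !fk.
  move=> x l l' xM q0x xl xl' E; have := fk x l q0x; have := fk x l' q0x.
  by rewrite E; case: (ccol l' == _); case: (flip x l); case: (flip x l').
Qed.

Lemma mem_ends v c h : (v \in ends c) = (v == vtx (c, h)) || (v == vtx (c, ~~ h)).
Proof. by rewrite !inE; case: h => //; rewrite orbC. Qed.

Lemma ends_block_cycle q v : q \in M ->
  (vdeg ends U_(nw q) v + vdeg ends U_(se q) v =
   vdeg ends U_(ne q) v + vdeg ends U_(sw q) v)%N.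
Proof.
move=> qM; have Aq := adjM qM.
have deg c h : vdeg ends U_(c) v = ((v == vtx (c, h)) + (v == vtx (c, ~~ h)))%N.
  rewrite vdegU (mem_ends v c h).
  have [->|//] := eqVneq v (vtx (c, h)).
  suff /negPf->: vtx (c, h) != vtx (c, ~~ h) by [].
  by case: h => /=; [rewrite eq_sym|]; apply: no_loop.
have b1 : in_block q (nw q) by apply/(in_blockP Aq); constructor 1.
have b2 : in_block q (ne q) by apply/(in_blockP Aq); constructor 2.
have b3 : in_block q (sw q) by apply/(in_blockP Aq); constructor 3.
have b4 : in_block q (se q) by apply/(in_blockP Aq); constructor 4.
have row c c' : in_block q c -> in_block q c' -> crow c = crow c' ->
    vtx (c, flip q c) = vtx (c', flip q c').
  move=> qc qc' E; apply/eqP/vtxP/connect1/existsP; exists q.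
  by rewrite qM qc qc' E !eqxx.
have col c c' : in_block q c -> in_block q c' -> ccol c = ccol c' ->
    vtx (c, ~~ flip q c) = vtx (c', ~~ flip q c').
  move=> qc qc' E; apply/eqP/vtxP/connect1/existsP; exists q.
  by rewrite qM qc qc' E !eqxx orbT.
rewrite (deg (nw q) (flip q (nw q))) (deg (ne q) (flip q (ne q))).
rewrite (deg (sw q) (flip q (sw q))) (deg (se q) (flip q (se q))).
rewrite (row _ (ne q) b1 b2) ?cornerE // (row _ (se q) b3 b4) ?cornerE //.
rewrite (col _ (sw q) b1 b3) ?cornerE // (col _ (se q) b2 b4) ?cornerE //.
ring.
Qed.

Section Potential.
Variables (y : cell -> rat) (ybal : balanced M y).

(** A balanced weight on the block of [q] is the sum of a function of the row
    and of a function of the column; this is the former. *)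
Definition row_part (q : minor_index m n) (c : cell) : rat :=
  if crow c == mrow q then y (nw q) else y (sw q).

Lemma col_part q c c' : q \in M -> in_block q c -> in_block q c' -> ccol c = ccol c' ->
  y c - row_part q c = y c' - row_part q c'.
Proof.
move=> qM; have Aq := adjM qM; have := ybal qM.
move=> Y /(in_blockP Aq) + /(in_blockP Aq); rewrite /row_part.
case=> -> [] ->; rewrite !cornerE ?eqxx ?[_.+1 == _]gtn_eqF // => E;
  by [exfalso; lia | lra].
Qed.

(** Moving a constant from the row parts to the column parts, separately for
    every minor, makes them agree at all untwisted shared cells, because these
    edges form a forest.  One constant per component is still free, and the
    twist turns the remaining condition at the twisted cell into a linear
    equation for it with coefficient 2. *)
Lemma adjusting_constants : exists delta : minor_index m n -> rat,
  (forall x z c, Gamma M x z -> ~~ twisted x z -> ~~ twisted z x ->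
     in_block x c -> in_block z c -> row_part x c + delta x = row_part z c + delta z) /\
  (forall x z c, twisted x z -> in_block x c -> in_block z c ->
     row_part z c + delta z = y c - (row_part x c + delta x)).
Proof.
pose chi x z : rat := if [pick c | in_block x c && in_block z c] is Some c
  then row_part x c - row_part z c else 0.
have chiE x z c : Gamma M x z -> in_block x c -> in_block z c ->
    chi x z = row_part x c - row_part z c.
  move=> g xc zc; rewrite /chi; case: pickP => [k /andP[xk zk]|/(_ c)]; last by rewrite xc zc.
  by rewrite (Gamma_corner_uniq adjM chess g xc zc xk zk).
have [||x|delta dE] := acyclic_potential (chi := chi) _ _ twisted_acyclic.
- by move=> x z; rewrite GC [~~ twisted x z && _]andbC.
- by move=> x; rewrite Gamma_irr.
- move=> z; rewrite /chi (eq_pick (Q := fun c => in_block x c && in_block z c)); last first.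
    by move=> c; rewrite /= andbC.
  by case: pickP => [c _|_]; rewrite ?oppr0 // opprB.
pose gap p q : rat := if [pick c | in_block p c && in_block q c] is Some c
  then y c - row_part p c - delta p - row_part q c - delta q else 0.
have gapE p q c : Gamma M p q -> in_block p c -> in_block q c ->
    gap p q = y c - row_part p c - delta p - row_part q c - delta q.
  move=> g pc qc; rewrite /gap; case: pickP => [k /andP[pk qk]|/(_ c)]; last by rewrite pc qc.
  by rewrite (Gamma_corner_uniq adjM chess g pc qc pk qk).
pose twist_of x (pq : minor_index m n * minor_index m n) :=
  twisted pq.1 pq.2 && connect (Gamma M) x pq.1.
pose t x := if pick (twist_of x) is Some pq then gap pq.1 pq.2 / 2 else 0.
have tE x z : connect (Gamma M) x z -> t x = t z.
  move=> xz; rewrite /t (eq_pick (Q := twist_of z)) // => pq.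
  by rewrite /twist_of (same_connect GCC xz).
have tgap p q : twisted p q -> t p = gap p q / 2.
  move=> tpq; rewrite /t; case: pickP => [[p' q'] /= /andP[t' con]|/(_ (p, q))]; last first.
    by rewrite /twist_of /= tpq connect0.
  by have [-> ->] := twisted_uniq tpq t' con.
exists (fun x => delta x + t x); split=> [x z c g n1 n2 xc zc|p q c tpq pc qc].
  rewrite (dE x z) ?g ?n1 // (chiE x z c g xc zc) (tE x z (connect1 g)); lra.
have [g _] := twistedG tpq.
rewrite -(tE p q (connect1 g)) (tgap p q tpq) (gapE p q c g pc qc); lra.
Qed.

Lemma ends_vertex_potential :
  exists a : 'I_#|{: cell * bool}| -> rat, forall k, y k = \sum_(v in ends k) a v.
Proof.
have [delta [dE tE]] := adjusting_constants.
pose part q c := row_part q c + delta q.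
pose b c (h : bool) : rat := if [pick q in M | in_block q c] is Some q
  then (if h == flip q c then part q c else y c - part q c) else (if h then 0 else y c).
have bE q c h : q \in M -> in_block q c ->
    b c h = if h == flip q c then part q c else y c - part q c.
  move=> qM qc; rewrite /b; case: pickP => [x /andP[xM xc]|/(_ q)]; last by rewrite qM qc.
  have [->//|xq] := eqVneq x q.
  have qx : q != x by rewrite eq_sym.
  rewrite (flipP xM qM qx qc xc) (flipP qM xM xq xc qc).
  have g := Gamma_share adjM xM qM xq xc qc.
  case: (boolP (twisted x q)) => [t|nt].
    have [_ r] := twistedG t.
    have -> : twisted q x = false.
      by apply/negP=> /twistedG[_ r']; move: r r'; clear; lia.
    have E := tE _ _ _ t xc qc; rewrite -!/(part _ _) in E; rewrite E.
    by case: h => //=; rewrite opprB addrC subrK.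
  case: (boolP (twisted q x)) => [t|nt'].
    have E := tE _ _ _ t qc xc; rewrite -!/(part _ _) in E; rewrite E.
    by case: h => //=; rewrite opprB addrC subrK.
  have E := dE _ _ _ g nt nt' xc qc; rewrite -!/(part _ _) in E; rewrite E.
  by case: h.
have b_inv f g : connect link f g -> b f.1 f.2 = b g.1 g.2.
  apply: link_invariant => q c c' qM qc qc' E.
    by rewrite !(bE q) // !eqxx /part /row_part E.
  have nf (h : bool) : (~~ h == h) = false by case: h.
  rewrite !(bE q) // !nf /part !opprD !addrA; congr (_ - _); exact: (col_part qM qc qc' E).
exists (fun v => b (enum_val v).1 (enum_val v).2) => k.
have bv f : b (enum_val (vtx f)).1 (enum_val (vtx f)).2 = b f.1 f.2.
  by rewrite /vtx enum_rankK; apply/esym/b_inv; apply: connect_root.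
rewrite big_setU1 ?inE ?no_loop //= big_set1 !bv /= /b.
case: pickP => [q _|_]; last by rewrite addr0.
by case: (flip q k) => /=; rewrite ?subrK // addrC subrK.
Qed.

End Potential.

(** The row and column numbers are balanced weights, so that a cell is determined
    by its two vertices. *)
Lemma ends_inj : injective ends.
Proof.
move=> k l E.
have same (f : cell -> nat) : balanced M (fun c => (f c)%:R : rat) -> f k = f l.
  move=> /ends_vertex_potential[a aE]; apply/eqP; rewrite -(eqr_nat rat) !aE.
  by rewrite E.
by apply: cell_inj; apply: same => q /adjM Aq; rewrite !cornerE // addrC.
Qed.

Lemma card_ends k : #|ends k| = 2.
Proof. by rewrite cards2 no_loop. Qed.

End Graph.

Theorem theorem4 (K : fieldType) (m n : nat) (M : {set minor_index m n})
    (adjM : forall q : minor_index m n, q \in M -> adjacent q) :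
  (exists (d : nat) (G : sgraph d),
     equal_up_to_renaming (@in_minor_ideal K m n M) (@in_toric_ideal K d G))
  <->
  (chessboard M /\
   no_cycle_of_length (Gamma M) 4 /\
   components_at_most_one_cycle (Gamma M) M).
Proof.
apply: iff_trans (toric_presentation _) _; split.
  move=> [d [e [einj e2 IE]]]; split; first exact: (toric_chessboard adjM IE).
  split; first exact: (toric_no_4cycle adjM IE).
  exact: (toric_at_most_one_cycle adjM einj e2 IE).
move=> [chess [no4 one]].
have [twisted [tG tU tA]] := twisted_edges adjM chess one.
exists _, (ends M twisted); split.
- exact: (ends_inj adjM chess tG tU tA).
- exact: (card_ends adjM chess tG tU).
- apply: (minor_idealE adjM chess no4 _ _).
    by move=> q v; apply: (ends_block_cycle adjM chess tG tU).
  by move=> y; apply: (ends_vertex_potential adjM chess tG tU tA).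
Qed.
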